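(* Let $X$ be a proper metric space and $n\ge 0$. Then $\dim^c X\le n$ if and only if $\dim\nu X\le n$ (covering dimension of the Higson corona).
   Context: A metric space is proper if every closed ball is compact. A map $f:(X,d_X)\to(Y,d_Y)$ is asymptotically Lipschitz if there are $\lambda,s\ge0$ with $d_Y(f(x),f(x'))\le\lambda d_X(x,x')+s$ for all $x,x'$. A map is proper if preimages of compact sets are compact. By definition $\dim^cX\le n$ means: for every closed subset $A\subset X$ (with the induced metric) and every continuous proper asymptotically Lipschitz map $f:A\to\mathbb R^{n+1}$ (Euclidean metric) there exists a continuous proper asymptotically Lipschitz map $\bar f:X\to\mathbb R^{n+1}$ with $\bar f|_A=f$. For a proper metric space $X$, a bounded continuous $f:X\to\mathbb R$ is a Higson function if for every $R>0$, $\mathrm{Var}_Rf(x)=\sup_{y\in B_R(x)}|f(x)-f(y)|\to0$ as $x\to\infty$; the Higson compactification $\bar X$ is the closure of the image of $X$ under $x\mapsto(f(x))_{f}$ in $\mathbb R^{C_h(X)}$, $C_h(X)$ the set of Higson functions, and the Higson corona is $\nu X=\bar X\setminus X$. *)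

(* Defs.v *)
From HB Require Import structures.
From mathcomp Require Import all_boot all_order all_algebra.
From mathcomp Require Import all_classical all_reals all_analysis.
Set Implicit Arguments. Unset Strict Implicit. Unset Printing Implicit Defensive.
Import Order.TTheory GRing.Theory Num.Theory.
Import numFieldTopology.Exports numFieldNormedType.Exports.
Local Open Scope classical_set_scope.
Local Open Scope ring_scope.

Section MetricNotions.
Variable R : realType.

Definition is_metric (T : Type) (d : T -> T -> R) : Prop :=
  [/\ forall x y, d x y = 0 <-> x = y,
      forall x y, d x y = d y x &
      forall x y z, d x z <= d x y + d y z].

Definition mopen (T : Type) (d : T -> T -> R) (U : set T) : Prop :=
  forall x, U x -> exists2 e : R, 0 < e & forall y, d x y < e -> U y.

Definition mclosed (T : Type) (d : T -> T -> R) (A : set T) : Prop :=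
  mopen d (~` A).

Definition mcompact (T : Type) (d : T -> T -> R) (K : set T) : Prop :=
  forall (I : Type) (U : I -> set T),
    (forall i, mopen d (U i)) -> K `<=` \bigcup_i U i ->
    exists (m : nat) (g : 'I_m -> I), K `<=` \bigcup_j U (g j).

Definition closed_ball (T : Type) (d : T -> T -> R) (x : T) (r : R) : set T :=
  [set y | d x y <= r].

Definition proper_metric (T : Type) (d : T -> T -> R) : Prop :=
  forall x r, mcompact d (closed_ball d x r).

Definition mcont_on (T U : Type) (dT : T -> T -> R) (dU : U -> U -> R)
  (A : set T) (f : T -> U) : Prop :=
  forall x, A x -> forall e : R, 0 < e -> exists2 del : R, 0 < del &
    forall y, A y -> dT x y < del -> dU (f x) (f y) < e.

(** Proper map on [A]: preimages (in [A]) of compact sets are compact.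
    Compactness of a subset of [A] for the induced metric is compactness
    of that subset in [T]. *)
Definition mproper_on (T U : Type) (dT : T -> T -> R) (dU : U -> U -> R)
  (A : set T) (f : T -> U) : Prop :=
  forall K : set U, mcompact dU K -> mcompact dT (A `&` f @^-1` K).

Definition asymp_lip_on (T U : Type) (dT : T -> T -> R) (dU : U -> U -> R)
  (A : set T) (f : T -> U) : Prop :=
  exists lam s : R, [/\ 0 <= lam, 0 <= s &
    forall x x', A x -> A x' -> dU (f x) (f x') <= lam * dT x x' + s].

Definition eucl (m : nat) (a b : 'rV[R]_m) : R :=
  Num.sqrt (\sum_(i < m) (a ord0 i - b ord0 i) ^+ 2).

Definition dimc_le (T : Type) (d : T -> T -> R) (n : nat) : Prop :=
  forall (A : set T), mclosed d A ->
  forall f : T -> 'rV[R]_n.+1,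
    mcont_on d (@eucl n.+1) A f -> mproper_on d (@eucl n.+1) A f ->
    asymp_lip_on d (@eucl n.+1) A f ->
    exists fbar : T -> 'rV[R]_n.+1,
      [/\ mcont_on d (@eucl n.+1) setT fbar,
          mproper_on d (@eucl n.+1) setT fbar,
          asymp_lip_on d (@eucl n.+1) setT fbar &
          forall x, A x -> fbar x = f x].

(** Higson functions: bounded continuous f with Var_r f(x) -> 0 as x -> oo,
    where Var_r f(x) = sup_{y in B_r(x)} |f x - f y| and B_r(x) is the open ball. *)
Definition higson (T : Type) (d : T -> T -> R) (f : T -> R) : Prop :=
  [/\ exists M : R, forall x, `|f x| <= M,
      mcont_on d (fun a b : R => `|a - b|) setT f &
      forall r : R, 0 < r -> forall e : R, 0 < e ->
        exists K : set T, mcompact d K /\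
          forall x, ~ K x -> forall y, d x y < r -> `|f x - f y| <= e].

Definition higson_fun (T : Type) (d : T -> T -> R) := {f : T -> R | higson d f}.

Definition higson_map (T : Type) (d : T -> T -> R) (x : T)
  : {ptws higson_fun d -> (R : topologicalType)} := fun f => proj1_sig f x.
Arguments higson_map {T} d x.

Arguments higson_fun {T} d.
Definition higson_compactification (T : Type) (d : T -> T -> R)
  : set {ptws higson_fun d -> (R : topologicalType)} := closure (([set higson_map d x | x in [set: T]] : set {ptws higson_fun d -> (R : topologicalType)})).

Arguments higson_compactification {T} d _.
Definition higson_corona (T : Type) (d : T -> T -> R)
  : set {ptws higson_fun d -> (R : topologicalType)} :=
  higson_compactification d `\` ([set higson_map d x | x in [set: T]] : set {ptws higson_fun d -> (R : topologicalType)}).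

End MetricNotions.
Arguments higson_fun {R T} d.
Arguments higson_map {R T} d x _.
Arguments higson_compactification {R T} d _.
Arguments higson_corona {R T} d _.


(** Covering dimension of a subspace [S] of a topological space [T]:
    every finite open cover of [S] has a finite open refinement covering [S]
    of order <= n+1 (each point of [S] lies in at most n+1 members).
    Open sets of the subspace are written as traces of open sets of [T]. *)
Definition covdim_le (T : topologicalType) (S : set T) (n : nat) : Prop :=
  forall (k : nat) (U : 'I_k -> set T),
    (forall j, open (U j)) -> S `<=` \bigcup_j U j ->
    exists (m : nat) (V : 'I_m -> set T),
      [/\ forall i, open (V i),
          S `<=` \bigcup_i V i,
          forall i, exists j, V i `&` S `<=` U j `&` S &
          forall x, S x -> forall J : {set 'I_m},
            (forall i, i \in J -> V i x) -> (#|J| <= n.+1)%N].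

(* Main.v *)
(* The bridge between [X] and its corona is Higson functions and filters: points
   of the corona are limits of filters on [X] leaving every ball, and finite open
   covers of the corona are realised by families of Higson functions.

   If [dim^c X <= n]: take Higson functions [p_0, ..., p_(n+1)] subordinate to an
   open cover of the corona and let [u] be the image of [p] in
   [R^(n+2) / R(1, ..., 1)]. For a radius [r -> oo] growing slowly with respect to
   the oscillation of [u], the map [r u] is asymptotically Lipschitz, and proper
   where [u] is bounded away from [0]. It extends from there to [X]; the direction
   [w] of the extension is a Higson map, and [w_i - min w] is a shrinking of the
   cover with empty intersection, which is enough to bound the dimension.

   If [dim nu X <= n]: extend [f] to a continuous asymptotically Lipschitz [F],
   choose a slow radius [h] with [2 h <= |f|] on [A] and let [u = F / max(|F|, h, 1)],
   a Higson map. A partition of unity of order [n + 1] on the corona, with values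
   at points in general position, gives a Higson map [phi] close to [u] (up to a
   positive factor) that is bounded away from [0] at infinity. Then replace [F] by
   [phi] times a slow radius where [|F| < h], interpolating up to [|F| = 2 h]. *)
From HB Require Import structures.
Require Import Defs.
From mathcomp Require Import all_boot all_order all_algebra.
From mathcomp Require Import all_classical all_reals all_analysis.
From mathcomp Require Import ring lra.
Set Implicit Arguments. Unset Strict Implicit. Unset Printing Implicit Defensive.
Import Order.TTheory GRing.Theory Num.Theory.
Import numFieldTopology.Exports numFieldNormedType.Exports.
Local Open Scope classical_set_scope.
Local Open Scope ring_scope.

(** * Slowly growing Lipschitz radii *)

Definition rdist (R : realType) (a b : R) : R := `|a - b|.

Section Metric.
Variables (R : realType) (X : Type) (d : X -> X -> R).
Hypothesis hd : is_metric d.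

Lemma distxx x : d x x = 0. Proof. by case: hd => h _ _; apply/h. Qed.
Lemma distC x y : d x y = d y x. Proof. by case: hd. Qed.
Lemma dist_triangle x y z : d x z <= d x y + d y z. Proof. by case: hd. Qed.
Lemma dist_ge0 x y : 0 <= d x y.
Proof. by have := dist_triangle x y x; rewrite distxx (distC y x); lra. Qed.

(** Relative neighbourhoods of [x] in [A], as a filter: [mcontP] turns continuity on [A] into a
    limit, so that the algebra of limits applies. *)
Definition mnbhs (A : set X) (x : X) : set_system X :=
  filter_from [set e : R | 0 < e] (fun e => [set y | A y /\ d x y < e]).

Global Instance mnbhs_filter A x : Filter (mnbhs A x).
Proof.
apply: filter_from_filter; first by exists 1 => /=.
move=> e f /= e0 f0; exists (Num.min e f) => /=; first by rewrite lt_min e0.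
by move=> y [Ay]; rewrite lt_min => /andP[h1 h2].
Qed.

Lemma mcontP A (f : X -> R) :
  mcont_on d (@rdist R) A f <-> forall x, A x -> f @ mnbhs A x --> f x.
Proof.
split=> h x Ax.
- apply/cvgrPdist_lt => e e0; have [del del0 H] := h x Ax e e0.
  by exists del => // y [Ay dy]; exact: H.
- move=> e e0; have /cvgrPdist_lt/(_ _ e0)[del del0 H] := h x Ax.
  by exists del => // y Ay dy; exact: H.
Qed.

Lemma mcont_cvg A (f : X -> R) x :
  mcont_on d (@rdist R) A f -> A x -> f @ mnbhs A x --> f x.
Proof. by move=> /mcontP; exact. Qed.

(** The filter of [x] tending to infinity. It is improper when [X] is bounded, hence only a [Filter]
    instance. *)
Definition far (x0 : X) : set_system X :=
  filter_from [set: R] (fun r => [set x | r < d x0 x]).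

Global Instance far_filter x0 : Filter (far x0).
Proof.
apply: filter_from_filter; first by exists 0.
move=> e f _ _; exists (Num.max e f) => // y.
by rewrite /= gt_max => /andP[h1 h2].
Qed.

(** Exchanging [x] and [y] in the one-sided bound gives the two-sided one for the infimum. The
    infimum need not be attained, so later proofs work with the near-minimisers of the second
    clause. *)
Lemma inf_lipschitz (I : Type) (psi : I -> X -> R) (L : R) (i0 : I) :
  (forall i x y, psi i x <= psi i y + L * d x y) ->
  (forall x, exists b, forall i, b <= psi i x) ->
  exists g : X -> R,
    [/\ forall x i, g x <= psi i x,
        forall x e, 0 < e -> exists i, psi i x < g x + e &
        forall x y, `|g x - g y| <= L * d x y].
Proof.
move=> psiL psib; pose S x := [set psi i x | i in [set: I]].
have Sinf x : has_inf (S x).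
  split; first by exists (psi i0 x); exists i0.
  by have [b hb] := psib x; exists b => _ [i _ <-].
have le1 x i : inf (S x) <= psi i x by apply: ge_inf; [case: (Sinf x)|exists i].
have lt1 x e : 0 < e -> exists i, psi i x < inf (S x) + e.
  by move=> e0; have [_ [i _ <-] h] := inf_adherent e0 (Sinf x); exists i.
have half x y : inf (S x) <= inf (S y) + L * d x y.
  apply/ler_addgt0Pr => e e0; have [i hi] := lt1 y e e0.
  by have := le1 x i; have := psiL i x y; lra.
exists (fun x => inf (S x)); split => // x y.
by have := half x y; have := half y x; rewrite (distC y x) ler_norml; lra.
Qed.

Lemma far_dist x0 M : \forall x \near far x0, M <= d x0 x.
Proof. by exists M => // x /= /ltW. Qed.

(* The 1-Lipschitz regularisation of the largest admissible radius. *)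
Lemma slow_radius (x0 : X) (P : X -> R -> Prop) :
  (forall x, P x 0) ->
  (forall x s t, 0 <= s -> s <= t -> P x t -> P x s) ->
  (forall t, \forall x \near far x0, P x t) ->
  exists r : X -> R,
    [/\ forall x, 0 <= r x, forall x y, `|r x - r y| <= d x y,
        forall M, \forall x \near far x0, M <= r x & forall x, P x (r x)].
Proof.
(* The condition [t <= d x0 x] bounds the set without stopping its supremum from tending to
   infinity. *)
move=> P0 Pdown Pfar; pose S x := [set t | [/\ 0 <= t, t <= d x0 x & P x t]].
have Ssup x : has_sup (S x).
  split; first by exists 0; split => //; exact: dist_ge0.
  by exists (d x0 x) => t [].
pose g x := sup (S x).
have g0 x : 0 <= g x.
  by apply: (ub_le_sup (proj2 (Ssup x))); split => //; exact: dist_ge0.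
have gP x t : 0 <= t -> t < g x -> P x t.
  move=> t0 tg; have e0 : 0 < g x - t by lra.
  have [s [s0 _ Ps] hs] := sup_adherent e0 (Ssup x).
  by apply: (Pdown x t s) => //; rewrite /g in hs; lra.
have gfar M : \forall x \near far x0, M <= g x.
  near=> x; apply: le_trans (_ : Num.max M 0 <= _).
    by rewrite le_max lexx.
  apply: (ub_le_sup (proj2 (Ssup x))); split.
  - by rewrite le_max lexx orbT.
  - by near: x; exact: far_dist.
  - by near: x; exact: Pfar.
have [||r [r1 r2 r3]] := @inf_lipschitz X (fun z x => g z + d x z) 1 x0.
- by move=> z x y; rewrite mul1r; have := dist_triangle x y z; lra.
- move=> x; exists 0 => z; by rewrite addr_ge0 // dist_ge0.
have r0 x : 0 <= r x.
  apply/ler_addgt0Pr => e e0; have [i hi] := r2 x e e0.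
  by have := g0 i; have := dist_ge0 x i; lra.
have rg x : r x <= g x by have := r1 x x; rewrite distxx addr0.
(* The supremum [g x] itself need not be admissible; halving puts the value strictly below it, where
   [gP] applies. *)
exists (fun x => r x / 2); split.
- by move=> x; have := r0 x; lra.
- move=> x y; rewrite -mulrBl normrM [`|2^-1|]ger0_norm; last by lra.
  by have := r3 x y; have := dist_ge0 x y; rewrite mul1r; lra.
(* A near-minimiser [z] for [x] either lies far out, where [g z >= 2 * M], or within [rho] of [x0],
   and then [d x z] exceeds [2 * M]. *)
- move=> M; have [rho _ hrho] := gfar (2 * M).
  exists (rho + 2 * M) => // x /= hx.
  suff : 2 * M <= r x by lra.
  apply/ler_addgt0Pr => e e0; have [z hz] := r2 x e e0.
  have [|] := ltP rho (d x0 z).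
    by move/hrho => /=; have := dist_ge0 x z; lra.
  by have := dist_triangle x0 z x; have := g0 z; rewrite (distC z x); lra.
- move=> x; have [gx|gx] := ltP 0 (g x).
    by apply: gP; have := r0 x; have := rg x; lra.
  have -> : r x / 2 = 0 by have := r0 x; have := rg x; lra.
  exact: P0.
Unshelve. all: by end_near. Qed.

End Metric.

(** * Extension of continuous asymptotically Lipschitz functions *)

Section Extension.
Variables (R : realType) (X : Type) (d : X -> X -> R).
Hypothesis hd : is_metric d.
Local Notation dist_ge0 := (dist_ge0 hd).
Local Notation distC := (distC hd).
Local Notation distxx := (distxx hd).
Local Notation dist_triangle := (dist_triangle hd).

Lemma lipschitz_mcont A (f : X -> R) L : 0 <= L ->
  (forall x y, `|f x - f y| <= L * d x y) -> mcont_on d (@rdist R) A f.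
Proof.
move=> L0 fL x Ax e e0; have L1 : 0 < L + 1 by lra.
exists (e / (L + 1)); first exact: divr_gt0.
move=> y Ay; rewrite ltr_pdivlMr // => h; rewrite /rdist.
by apply: le_lt_trans (fL _ _) _; have := dist_ge0 x y; lra.
Qed.

(* Hausdorff's formula: off [A], the extension is
   [inf_a (g a + M * (d a x / d(x, A) - 1))]. *)
Lemma tietze_metric (A : set X) (a0 : X) (g : X -> R) (s : R) :
  mclosed d A -> A a0 -> mcont_on d (@rdist R) A g ->
  (forall a, A a -> 0 <= g a <= s) ->
  exists T : X -> R, [/\ mcont_on d (@rdist R) setT T,
    exists B, forall x, `|T x| <= B & forall a, A a -> T a = g a].
Proof.
move=> clA Aa0 gcont gs; pose I := {a | A a}.
pose i0 : I := exist _ a0 Aa0.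
have s0 : 0 <= s by have /andP[] := gs _ Aa0; lra.
have [||D [D1 D2 D3]] := @inf_lipschitz _ _ d hd I (fun a x => d (sval a) x) 1 i0.
- by move=> a x y; rewrite mul1r (distC x y); exact: dist_triangle.
- by move=> x; exists 0 => a; exact: dist_ge0.
have D_ge0 x : 0 <= D x.
  apply/ler_addgt0Pr => e e0; have [a ha] := D2 x e e0.
  by have := dist_ge0 (sval a) x; lra.
have D_le a x : A a -> D x <= d a x by move=> Aa; exact: (D1 x (exist _ a Aa)).
have D_gt0 x : ~ A x -> 0 < D x.
  move=> nAx; have [e e0 he] := clA x nAx.
  apply: (lt_le_trans e0); apply/ler_addgt0Pr => e' e0'.
  have [[a Aa] /= ha] := D2 x e' e0'.
  have : e <= d x a by rewrite leNgt; apply/negP => /he.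
  by rewrite distC; lra.
have [M Ms M1] : exists2 M, M = s + 1 & 1 <= M by exists (s + 1) => //; lra.
(* [N] stands for [D * (T + M)]: clearing the denominator in Hausdorff's formula leaves an infimum
   of [(s + M)]-Lipschitz functions. *)
have [||N [N1 N2 N3]] := @inf_lipschitz _ _ d hd I
  (fun a x => g (sval a) * D x + M * d (sval a) x) (s + M) i0.
- move=> [a Aa] x y /=; have /andP[g0 g1] := gs a Aa.
  have h1 : D x - D y <= d x y by have := D3 x y; rewrite mul1r ler_norml; lra.
  have h2 := dist_triangle a y x; rewrite (distC y x) in h2.
  have h3 := dist_ge0 x y.
  have : g a * (D x - D y) <= s * d x y.
    by apply: le_trans (ler_wpM2l g0 h1) _; exact: ler_wpM2r.
  have : M * d a x <= M * (d a y + d x y) by (apply: ler_wpM2l; lra).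
  by lra.
- move=> x; exists 0 => -[a Aa] /=; have /andP[g0 g1] := gs a Aa.
  by apply: addr_ge0; apply: mulr_ge0 => //; [lra|exact: dist_ge0].
have N_le a x : A a -> N x <= g a * D x + M * d a x.
  by move=> Aa; exact: (N1 x (exist _ a Aa)).
have N_ge x b : (forall a, A a -> b <= g a * D x + M * d a x) -> b <= N x.
  move=> h; apply/ler_addgt0Pr => e e0; have [[a Aa] /= ha] := N2 x e e0.
  by have := h a Aa; lra.
pose T x := if pselect (A x) then g x else N x / D x - M.
have TA a : A a -> T a = g a by rewrite /T; case: pselect.
have TnA a : ~ A a -> T a = N a / D a - M by rewrite /T; case: pselect.
exists T; split => //; last first.
  exists (s + M) => x; have [Ax|nAx] := pselect (A x).
    by rewrite TA // ler_norml; have := gs x Ax; lra.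
  rewrite TnA //; have Dx := D_gt0 _ nAx.
  have : M <= N x / D x.
    rewrite ler_pdivlMr //; apply: N_ge => a Aa; have /andP[g0 g1] := gs a Aa.
    have : 0 <= g a * D x by rewrite mulr_ge0 // ltW.
    by have := ler_wpM2l (ltW (lt_le_trans ltr01 M1)) (D_le a x Aa); lra.
  have : N x / D x <= s + 2 * M.
    rewrite ler_pdivrMr //; have [[a Aa] /= ha] := D2 x (D x) Dx.
    apply: le_trans (N_le a x Aa) _; have /andP[g0 g1] := gs a Aa.
    have : g a * D x <= s * D x by (apply: ler_wpM2r => //; exact: ltW).
    have : M * d a x <= M * (2 * D x) by (apply: ler_wpM2l; lra).
    by lra.
  by rewrite ler_norml; lra.
move=> b _ e e0; have [Ab|nAb] := pselect (A b); last first.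
  have [e1 e10 he1] := clA b nAb.
  have Dc : D @ mnbhs d setT b --> D b.
    by apply: mcont_cvg => //; apply: (@lipschitz_mcont _ _ 1).
  have Nc : N @ mnbhs d setT b --> N b.
    by apply: mcont_cvg => //; apply: (@lipschitz_mcont _ _ (s + M)) => //; lra.
  have Db := D_gt0 _ nAb.
  have /cvgrPdist_lt/(_ _ e0)[del del0 h] :
      (fun x => N x / D x - M) @ mnbhs d setT b --> N b / D b - M.
    apply: cvgB; last exact: cvg_cst.
    by apply: cvgM => //; apply: cvgV => //; rewrite gt_eqF.
  exists (Num.min e1 del); first by rewrite lt_min e10.
  move=> y _; rewrite lt_min => /andP[y1 y2].
  by rewrite /rdist TnA // TnA; [exact: h|exact: he1].
have [eta eta0 heta] := gcont b Ab (e / 2) ltac:(lra).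
have /andP[gb0 gb1] := gs b Ab.
(* For [d b y < eta / 3], a point [a] at distance at least [eta] from [b] has [d a y >= 2 * D y].
   Its term in [N y / D y] is then at least [2 * M], too large to matter since [g b <= s <= M]. *)
exists (eta / 3); first by lra.
move=> y _ yd; rewrite /rdist (TA b) //.
have [Ay|nAy] := pselect (A y).
  rewrite TA //; apply: (@lt_trans _ _ (e / 2)); last by lra.
  by apply: heta => //; lra.
rewrite TnA //; have Dy := D_gt0 _ nAy; have Dyb := D_le b y Ab.
have lo : g b - e / 2 + M <= N y / D y.
  rewrite ler_pdivlMr //; apply: N_ge => a Aa; have /andP[g0 g1] := gs a Aa.
  have DaM : 0 <= M * (d a y - D y).
    by apply: mulr_ge0; have := D_le a y Aa; lra.
  have [ba|ba] := ltP (d b a) eta.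
    have := heta a Aa ba; rewrite /rdist ltr_norml => /andP[h1 h2].
    have : 0 <= (g a - (g b - e / 2)) * D y by (apply: mulr_ge0; lra).
    by lra.
  have : 0 <= M * (d a y - 2 * D y).
    apply: mulr_ge0 => //; first by lra.
    by have := dist_triangle b y a; rewrite (distC y a); lra.
  have : 0 <= (M - g b) * D y by (apply: mulr_ge0; lra).
  have : 0 <= g a * D y by (apply: mulr_ge0; lra).
  have : 0 <= e / 2 * D y by (apply: mulr_ge0; lra).
  by lra.
have up : N y / D y < g b + e + M.
  rewrite ltr_pdivrMr //.
  (* An almost nearest point [a] costs at most [M * k <= e / 4] beyond [g a + M], while [k <= 1]
     keeps [a] within [eta] of [b]. *)
  pose k := Num.min 1 (e / (4 * M)).
  have k0 : 0 < k by rewrite lt_min ltr01 /= divr_gt0 //; lra.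
  have k1 : k <= 1 by rewrite ge_min lexx.
  have kM : M * k <= e / 4.
    have : k <= e / (4 * M) by rewrite ge_min lexx orbT.
    by rewrite ler_pdivlMr; lra.
  have [[a Aa] /= ha] := D2 y (k * D y) (mulr_gt0 k0 Dy).
  apply: le_lt_trans (N_le a y Aa) _.
  have kD : 0 <= (1 - k) * D y by (apply: mulr_ge0; lra).
  have : d b a < eta.
    by have := dist_triangle b y a; rewrite (distC y a); lra.
  move/(heta a Aa); rewrite /rdist ltr_norml => /andP[h1 h2].
  have : 0 <= (g b + e / 2 - g a) * D y by (apply: mulr_ge0; lra).
  have : 0 <= M * (D y + k * D y - d a y) by (apply: mulr_ge0; lra).
  have : 0 <= (e / 4 - M * k) * D y by (apply: mulr_ge0; lra).
  have : 0 < e / 4 * D y by (apply: mulr_gt0; lra).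
  by lra.
by rewrite ltr_norml; lra.
Qed.

(** McShane's extension [G] is Lipschitz but may fall below [f] on [A] by up to [s]. The defect
    [f - G] is continuous with values in [[0, s]]; its bounded continuous extension repairs this at
    the cost of an additive constant. *)
Lemma asymp_lip_extension (A : set X) (f : X -> R) :
  mclosed d A -> mcont_on d (@rdist R) A f -> asymp_lip_on d (@rdist R) A f ->
  exists F : X -> R, [/\ mcont_on d (@rdist R) setT F,
    asymp_lip_on d (@rdist R) setT F & forall a, A a -> F a = f a].
Proof.
move=> clA fcont [lam [s [lam0 s0 fl]]].
have [[a0 Aa0]|An0] := pselect (exists a, A a); last first.
  exists (fun=> 0); split.
  - by apply: (@lipschitz_mcont _ _ 0) => // x y; rewrite subrr normr0 mul0r.
  - by exists 0, 0; split => // x x' _ _; rewrite /rdist subrr normr0 mul0r addr0.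
  - by move=> a Aa; case: An0; exists a.
have fl1 a b : A a -> A b -> f a <= f b + lam * d a b + s.
  by move=> Aa Ab; have := fl a b Aa Ab; rewrite /rdist ler_norml; lra.
have [||G [G1 G2 G3]] := @inf_lipschitz _ _ d hd {a | A a}
  (fun a x => f (sval a) + lam * d (sval a) x) lam (exist _ a0 Aa0).
- move=> [a Aa] x y /=; have := ler_wpM2l lam0 (dist_triangle a y x).
  by rewrite (distC y x); lra.
- move=> x; exists (f a0 - s - lam * d a0 x) => -[a Aa] /=.
  have := fl1 a0 a Aa0 Aa; have := ler_wpM2l lam0 (dist_triangle a0 x a).
  by rewrite (distC x a); lra.
have Gf a : A a -> 0 <= f a - G a <= s.
  move=> Aa; have := G1 a (exist _ a Aa); rewrite /= distxx.
  suff : f a - s <= G a by lra.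
  apply/ler_addgt0Pr => e e0; have [[b Ab] /= hb] := G2 a e e0.
  by have := fl1 a b Aa Ab; rewrite (distC a b); lra.
have Gcont B : mcont_on d (@rdist R) B G by exact: (@lipschitz_mcont _ _ lam).
have [|T [Tcont [B TB] TA]] := @tietze_metric A a0 (fun a => f a - G a) s clA Aa0 _ Gf.
  apply/mcontP => x Ax.
  by apply: cvgB; exact: mcont_cvg.
exists (fun x => G x + T x); split.
- apply/mcontP => x Ax.
  by apply: cvgD; exact: mcont_cvg.
- have B0 : 0 <= B by apply: le_trans (TB a0).
  exists lam, (B + B); split => //; first by lra.
  move=> x y _ _; rewrite /rdist.
  have := G3 x y; have := TB x; have := TB y; rewrite !ler_norml; lra.
- by move=> a Aa; rewrite TA // addrC subrK.
Qed.

End Extension.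

(** * Higson functions *)

Section Higson.
Variables (R : realType) (X : Type) (d : X -> X -> R).
Hypothesis hd : is_metric d.
Hypothesis hp : proper_metric d.
Variable x0 : X.
Local Notation dist_ge0 := (dist_ge0 hd).
Local Notation distC := (distC hd).
Local Notation dist_triangle := (dist_triangle hd).
Local Notation far := (far d x0).

Lemma mopen_ball r : mopen d [set y | d x0 y < r].
Proof.
move=> y /= hy; exists (r - d x0 y); first by lra.
by move=> z hz; have := dist_triangle x0 y z; lra.
Qed.

Lemma mcompact_bounded (K : set X) :
  mcompact d K -> exists r, forall x, K x -> d x0 x <= r.
Proof.
move=> /(_ nat (fun k => [set y | d x0 y < k%:R])) [|x _|m [g hg]].
- by move=> k; exact: mopen_ball.
- exists (Num.bound (d x0 x)) => //=; exact: archi_boundP (dist_ge0 _ _).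
exists (\sum_(j < m) (g j)%:R) => x /hg [j _ /=] /ltW h; apply: le_trans h _.
by rewrite (bigD1 j) //= lerDl sumr_ge0.
Qed.

(** In a proper space the compact sets and the closed balls about [x0] are cofinal, so the decay of
    the variation can be read along [far]. *)
Lemma higsonP (f : X -> R) : higson d f <->
  [/\ exists M : R, forall x, `|f x| <= M, mcont_on d (@rdist R) setT f &
      forall r e : R, 0 < r -> 0 < e ->
        \forall x \near far, forall y, d x y < r -> `|f x - f y| <= e].
Proof.
split=> -[fb fc fv]; split => // r.
- move=> e r0 e0; have [K [cK hK]] := fv r r0 e e0.
  have [rho hrho] := mcompact_bounded cK.
  exists rho => // x /= hx; apply: hK => /hrho; lra.
- move=> r0 e e0; have [rho _ hrho] := fv r e r0 e0.
  exists (Defs.closed_ball d x0 rho); split; first exact: hp.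
  move=> x hx y; apply: hrho => /=; rewrite ltNge; exact/negP.
Qed.

(** The algebraic closure properties below reduce to this one estimate on increments. *)
Lemma higson_dominated (f g h : X -> R) C :
  higson d f -> higson d g -> 0 <= C ->
  (forall x y, `|h x - h y| <= C * (`|f x - f y| + `|g x - g y|)) ->
  (exists M, forall x, `|h x| <= M) -> higson d h.
Proof.
move=> /higsonP[_ fc fv] /higsonP[_ gc gv] C0 hC hb.
have C1 : 0 < 4 * (C + 1) by lra.
have small (a b e : R) : 0 <= a -> 0 <= b -> 0 < e ->
    a <= e / (4 * (C + 1)) -> b <= e / (4 * (C + 1)) -> C * (a + b) < e.
  move=> a0 b0 e0; rewrite !ler_pdivlMr // => ha hb'.
  have : 0 <= C * b by exact: mulr_ge0.
  have : 0 <= C * a by exact: mulr_ge0.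
  lra.
apply/higsonP; split => //.
- move=> x _ e e0; have e1 : 0 < e / (4 * (C + 1)) by exact: divr_gt0.
  have [d1 d10 h1] := fc x I _ e1; have [d2 d20 h2] := gc x I _ e1.
  exists (Num.min d1 d2); first by rewrite lt_min d10.
  move=> y _; rewrite lt_min => /andP[y1 y2].
  by apply: le_lt_trans (hC x y) _; apply: small => //; apply: ltW; [exact: h1|exact: h2].
- move=> r e r0 e0; have e1 : 0 < e / (4 * (C + 1)) by exact: divr_gt0.
  near=> x => y xy; apply: le_trans (hC x y) (ltW _); apply: small => //.
    by move: y xy; near: x; exact: fv.
  by move: y xy; near: x; exact: gv.
Unshelve. all: by end_near. Qed.

Lemma higson_bounded (f : X -> R) : higson d f ->
  exists2 M, 0 <= M & forall x, `|f x| <= M.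
Proof. by move=> [[M hM] _ _]; exists M => //; apply: le_trans (hM x0). Qed.

Lemma higson_cst c : higson d (fun=> c).
Proof.
apply/higsonP; split; first by exists `|c|.
- by move=> x _ e e0; exists 1 => // y _ _; rewrite /rdist subrr normr0.
- move=> r e r0 e0; exists 0 => // x _ y _; rewrite subrr normr0; exact: ltW.
Qed.

Lemma higsonD f g : higson d f -> higson d g -> higson d (fun x => f x + g x).
Proof.
move=> hf hg; apply: (higson_dominated hf hg ler01).
  move=> x y; rewrite mul1r (_ : _ - _ = (f x - f y) + (g x - g y)); last by ring.
  exact: ler_normD.
have [M _ hM] := higson_bounded hf; have [N _ hN] := higson_bounded hg.
by exists (M + N) => x; apply: le_trans (ler_normD _ _) (lerD _ _).
Qed.

Lemma higsonM f g : higson d f -> higson d g -> higson d (fun x => f x * g x).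
Proof.
move=> hf hg.
have [M M0 hM] := higson_bounded hf; have [N N0 hN] := higson_bounded hg.
apply: (higson_dominated (C := M + N) hf hg); first by lra.
  move=> x y; rewrite (_ : _ - _ = f x * (g x - g y) + g y * (f x - f y)); last by ring.
  apply: le_trans (ler_normD _ _) _; rewrite !normrM.
  have h1 := ler_wpM2r (normr_ge0 (g x - g y)) (hM x).
  have h2 := ler_wpM2r (normr_ge0 (f x - f y)) (hN y).
  have h3 := mulr_ge0 M0 (normr_ge0 (f x - f y)).
  have h4 := mulr_ge0 N0 (normr_ge0 (g x - g y)).
  lra.
exists (M * N) => x; rewrite normrM; exact: ler_pM.
Qed.

Lemma higson_norm f : higson d f -> higson d (fun x => `|f x|).
Proof.
move=> hf; apply: (higson_dominated hf hf ler01).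
  move=> x y; rewrite mul1r; apply: le_trans (ler_dist_dist _ _) _.
  by rewrite lerDl.
by have [M _ hM] := higson_bounded hf; exists M => x; rewrite normr_id.
Qed.

Lemma higsonZ c f : higson d f -> higson d (fun x => c * f x).
Proof. by move=> hf; apply: higsonM => //; exact: higson_cst. Qed.

Lemma higsonN f : higson d f -> higson d (fun x => - f x).
Proof.
by move=> hf; under eq_fun do rewrite -mulN1r; exact: higsonZ.
Qed.

Lemma higsonB f g : higson d f -> higson d g -> higson d (fun x => f x - g x).
Proof. by move=> hf hg; apply: higsonD => //; exact: higsonN. Qed.

Lemma higson_max f g :
  higson d f -> higson d g -> higson d (fun x => Num.max (f x) (g x)).
Proof.
move=> hf hg; under eq_fun do rewrite maxr_absE mulrC.
by apply: higsonZ; apply: higsonD; [exact: higsonD|apply: higson_norm; exact: higsonB].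
Qed.

Lemma higson_min f g :
  higson d f -> higson d g -> higson d (fun x => Num.min (f x) (g x)).
Proof.
move=> hf hg; under eq_fun do rewrite minr_absE mulrC.
by apply: higsonZ; apply: higsonB; [exact: higsonD|apply: higson_norm; exact: higsonB].
Qed.

Lemma higson_sum (I : Type) (s : seq I) (P : pred I) (f : I -> X -> R) :
  (forall i, higson d (f i)) -> higson d (fun x => \sum_(i <- s | P i) f i x).
Proof.
move=> hf; elim: s => [|i s IH].
  by under eq_fun do rewrite big_nil; exact: higson_cst.
under eq_fun do rewrite big_cons; case: (P i) => //; exact: higsonD.
Qed.

Lemma higson_bigmin (I : Type) (s : seq I) (f : I -> X -> R) :
  (forall i, higson d (f i)) ->
  higson d (fun x => \big[Num.min/0]_(i <- s) f i x).
Proof.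
move=> hf; elim: s => [|i s IH].
  by under eq_fun do rewrite big_nil; exact: higson_cst.
under eq_fun do rewrite big_cons; exact: higson_min.
Qed.

(** Bumps separate [X] from its corona: they have bounded support, hence limit 0 at infinity, but
    equal 1 at their centre. *)
Lemma higson_bump y : higson d (fun x => Num.max 0 (1 - d y x)).
Proof.
have dL x z : `|d y x - d y z| <= 1 * d x z.
  have := dist_triangle y x z; have := dist_triangle y z x.
  by rewrite (distC z x) mul1r ler_norml; lra.
have mxL (a b : R) : `|Num.max 0 (1 - a) - Num.max 0 (1 - b)| <= `|a - b|.
  rewrite !/Num.max.
  by case: ifPn; case: ifPn; rewrite -?leNgt !ler_norml => ? ?;
    have := ler_norm (a - b); have := ler_norm (b - a); rewrite (distrC b a); lra.
apply/higsonP; split.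
- exists 1 => x; rewrite ger0_norm ?le_max ?lexx // ge_max ler01 /=.
  by have := dist_ge0 y x; lra.
- apply: (lipschitz_mcont hd ler01) => x z.
  exact: le_trans (mxL _ _) (dL _ _).
- move=> r e r0 e0; exists (d x0 y + 1 + r) => // x /= hx z xz.
  have h1 := dist_triangle x0 y x; have h2 := dist_triangle y z x.
  rewrite (distC z x) in h2.
  have -> : Num.max 0 (1 - d y x) = 0 by apply/max_idPl; lra.
  have -> : Num.max 0 (1 - d y z) = 0 by apply/max_idPl; lra.
  by rewrite subrr normr0 ltW.
Qed.

(* The directions of an asymptotically Lipschitz map vary slowly where the map
   is large. *)
Lemma higson_quotient (F m : X -> R) :
  mcont_on d (@rdist R) setT F -> mcont_on d (@rdist R) setT m ->
  asymp_lip_on d (@rdist R) setT F -> asymp_lip_on d (@rdist R) setT m ->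
  (forall x, 1 <= m x) -> (forall x, `|F x| <= m x) ->
  (forall M, \forall x \near far, M <= m x) ->
  higson d (fun x => F x / m x).
Proof.
move=> Fc mc [L [s [L0 s0 FL]]] [K [t [K0 t0 mK]]] m1 Fm minf.
have m0 x : 0 < m x by apply: lt_le_trans (m1 x).
apply/higsonP; split.
- by exists 1 => x; rewrite normrM normfV (gtr0_norm (m0 x)) ler_pdivrMr // mul1r.
- apply/mcontP => x _; apply: cvgM; first exact: mcont_cvg.
  by apply: cvgV; [rewrite gt_eqF|exact: mcont_cvg].
- move=> r e r0 e0; near=> x => y xy.
  (* As [|F y / m y| <= 1], the numerator is at most [(L + K) * r + s + t] for [d x y < r], and
     [m x] tends to infinity. *)
  have -> : F x / m x - F y / m y =
      ((F x - F y) - F y / m y * (m x - m y)) / m x.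
    by field; rewrite !gt_eqF.
  rewrite normrM normfV (gtr0_norm (m0 x)) ler_pdivrMr //.
  have : (L + K) * r + s + t <= e * m x.
    rewrite (mulrC e) -ler_pdivrMr //; near: x; exact: minf.
  apply: le_trans; apply: le_trans (ler_normB _ _) _; rewrite normrM.
  have : `|F y / m y| * `|m x - m y| <= 1 * `|m x - m y|.
    apply: ler_wpM2r => //.
    by rewrite normrM normfV (gtr0_norm (m0 y)) ler_pdivrMr // mul1r.
  have := FL x y I I; have := mK x y I I; rewrite /rdist.
  have : L * d x y <= L * r by apply: ler_wpM2l => //; exact: ltW.
  have : K * d x y <= K * r by apply: ler_wpM2l => //; exact: ltW.
  lra.
Unshelve. all: by end_near. Qed.

(** The last clause makes [r * f i] asymptotically Lipschitz. It is compatible with [r] tending to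
    infinity: for fixed [t], distant pairs satisfy it because [f i] is bounded, nearby pairs because
    the variation decays far out. *)
Lemma higson_slow_radius (N : nat) (f : 'I_N -> X -> R) :
  (forall i, higson d (f i)) ->
  exists r : X -> R,
    [/\ forall x, 0 <= r x, forall x y, `|r x - r y| <= d x y,
        forall M, \forall x \near far, M <= r x &
        forall x y i, r x * `|f i x - f i y| <= 1 + d x y].
Proof.
move=> hf.
have [|||r [r1 r2 r3 r4]] := @slow_radius R X d hd x0
  (fun x t => forall y i, t * `|f i x - f i y| <= 1 + d x y).
- by move=> x y i; rewrite mul0r; have := dist_ge0 x y; lra.
- move=> x s t s0 st h y i; apply: le_trans (h y i); exact: ler_wpM2r.
- move=> t; pose t' := Num.max t 0.
  have [t0 tt] : 0 <= t' /\ t <= t' by rewrite /t' !le_max !lexx orbT.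
  suff : \forall x \near far, forall i y, t' * `|f i x - f i y| <= 1 + d x y.
    apply: filterS => x h y i; apply: le_trans (h i y); exact: ler_wpM2r.
  apply: filter_forall => i; have [M M0 hM] := higson_bounded (hf i).
  have /higsonP[_ _ fv] := hf i.
  have e0 : 0 < (t' + 1)^-1 by rewrite invr_gt0; lra.
  near=> x => y; have [xy|xy] := ltP (d x y) (t' * (2 * M) + 1).
    have : `|f i x - f i y| <= (t' + 1)^-1.
      move: y xy; near: x; apply: fv => //.
      by have := mulr_ge0 t0 M0; lra.
    have t1 : 0 < t' + 1 by lra.
    move=> h; have := ler_wpM2l (ltW t1) h; rewrite mulfV ?gt_eqF //.
    by have := normr_ge0 (f i x - f i y); have := dist_ge0 x y; lra.
  have : `|f i x - f i y| <= 2 * M.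
    by apply: le_trans (ler_normB _ _) _; have := hM x; have := hM y; lra.
  by move/(ler_wpM2l t0); lra.
- by exists r; split.
Unshelve. all: by end_near. Qed.

End Higson.

(** * The corona through filters on the space *)

Lemma compact_finite_subcover (T : topologicalType) (A : set T) (I : choiceType)
    (D : set I) (f : I -> set T) :
  compact A -> (forall i, D i -> open (f i)) ->
  (forall x, A x -> exists2 i, D i & f i x) ->
  exists (m : nat) (g : 'I_m -> I),
    (forall j, D (g j)) /\ A `<=` \bigcup_j f (g j).
Proof.
move=> cA fo Af; have [[a Aa]|A0] := pselect (exists a, A a); last first.
  have g (j : 'I_0) : I by case: j.
  by exists 0, g; split=> [[]//|x Ax]; case: A0; exists x.
pose Tp : ptopologicalType := HB.pack T (isPointed.Build T a).
have : @compact Tp A by [].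
rewrite compact_cover => {}cA.
have [|D' D'D AD'] := cA I D f fo.
  by move=> x /Af[i Di fi]; exists i.
exists (size (finmap.enum_fset D')), (tnth (in_tuple (finmap.enum_fset D'))); split=> [j|x Ax].
  by apply/set_mem/D'D; exact: mem_tnth.
have [i iD' fix_] := AD' x Ax.
have : i \in in_tuple (finmap.enum_fset D') by [].
by case/tnthP => j ij; exists j => //; rewrite -ij.
Qed.

Lemma cvg_ptws (I : Type) (T : topologicalType) (F : set_system {ptws I -> T})
    (w : {ptws I -> T}) : Filter F ->
  F --> w <-> forall i, (fun v : {ptws I -> T} => v i) @ F --> w i.
Proof.
move=> FF; split.
- move=> /cvg_sup Fw i U wU; move: wU; rewrite nbhsE => -[V [oV Vw] VU].
  have oW : @open (initial_topology (@proj I (fun=> T) i)) (@proj I (fun=> T) i @^-1` V).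
    apply: open_comp => // + _.
    exact: (@initial_continuous _ _ (@proj I (fun=> T) i)).
  apply: (Fw i); exists (@proj I (fun=> T) i @^-1` V); split => [||v /VU] //.
- move=> Fw; apply/cvg_sup => i U [V [[W] oW <-] Ww WU].
  rewrite nbhs_filterE; apply: filterS WU _; apply: (Fw i).
  exact: open_nbhs_nbhs.
Qed.

Lemma ultra_bounded_cvg (R : realType) (X : Type) (G : set_system X)
    (f : X -> R) (M : R) : UltraFilter G -> G [set x | `|f x| <= M] ->
  exists l : R, f @ G --> l.
Proof.
move=> GU GM; have cM : compact `[-M, M]%classic by exact: segment_compact.
have [|p [_ clp]] := cM (f @ G) (fmap_proper_filter _ _).
  by apply: (@filterS _ G _ _ _ _ GM) => x /=; rewrite in_itv /= ler_norml.
exists p => U pU; have [//|GnU] := in_ultra_setVsetC (f @^-1` U) GU.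
by have [z [/= h1 h2]] := clp (~` U) U GnU pU.
Qed.

Lemma filter_cvg_sum (R : realType) (X I : Type) (G : set_system X) (s : seq I)
    (P : pred I) (f : I -> X -> R) (l : I -> R) : Filter G ->
  (forall i, f i @ G --> l i) ->
  (fun x => \sum_(i <- s | P i) f i x) @ G --> \sum_(i <- s | P i) l i.
Proof.
move=> FG fl; elim: s => [|i s IH].
  by rewrite big_nil; under eq_fun do rewrite big_nil; exact: cvg_cst.
rewrite big_cons; under eq_fun do rewrite big_cons.
by case: (P i) => //; exact: cvgD.
Qed.

Section Corona.
Variables (R : realType) (X : Type) (d : X -> X -> R).
Hypothesis hd : is_metric d.
Hypothesis hp : proper_metric d.
Variable x0 : X.
Local Notation distxx := (distxx hd).
Local Notation dist_triangle := (dist_triangle hd).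
Local Notation far := (far d x0).
Local Notation T := {ptws higson_fun d -> (R : topologicalType)}.

Lemma eval_cvg (h : higson_fun d) (w : T) :
  (fun v : T => v h) @ nbhs w --> w h.
Proof. by move: h; apply/cvg_ptws; exact: cvg_id. Qed.

Definition bump (y : X) : higson_fun d :=
  exist _ _ (higson_bump hd hp x0 y).

Lemma bump_far (G : set_system X) y : Filter G -> far `<=` G ->
  sval (bump y) @ G --> (0 : R).
Proof.
move=> FG farG; apply/cvgrPdist_lt => e e0; apply: farG.
exists (d x0 y + 1) => // x /= hx; rewrite (_ : Num.max _ _ = 0) ?subrr ?normr0 //.
by apply/max_idPl; have := dist_triangle x0 y x; lra.
Qed.

(* A point of the corona is the limit of a filter on [X] that leaves every ball. *)
Definition escapes_to (G : set_system X) (w : T) :=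
  [/\ ProperFilter G, far `<=` G & forall h, sval h @ G --> w h].

(** The limit is not a point [x] of [X]: the coordinate [bump x] is 1 there but tends to 0 along
    [G]. *)
Lemma escapes_to_corona G w : escapes_to G w -> higson_corona d w.
Proof.
move=> [PG farG Gw].
have cG : (higson_map d : X -> T) @ G --> w by apply/cvg_ptws => h; exact: Gw.
split.
- move=> B /cG GB; have [x /= Bx] := @filter_ex _ G _ _ GB; by exists (higson_map d x).
- move=> [x _ xw]; have := Gw (bump x); rewrite -xw /higson_map /= => h.
  have h0 : sval (bump x) @ G --> (0 : R) by exact: bump_far.
  have /eqP : Num.max 0 (1 - d x x) = 0 :> R by exact: cvg_unique h h0.
  by rewrite distxx subr0 /Num.max ltr01 oner_eq0.
Qed.

(** [G] is the trace on [X] of the neighbourhoods of [w]. It leaves each ball because every point of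
    the ball is told apart from [w] by some Higson function, and by compactness finitely many of
    them serve the whole ball. *)
Lemma corona_escapes_to w : higson_corona d w -> exists G, escapes_to G w.
Proof.
move=> [clw nw]; pose G : set_system X := (filter_from (nbhs w)
  (fun N : set T => (higson_map d : X -> T) @^-1` N)).
have FG : Filter G.
  apply: filter_from_filter; first by exists setT; exact: filterT.
  by move=> A B wA wB; exists (A `&` B) => //; exact: filterI.
have GN N : nbhs w N -> G ((higson_map d : X -> T) @^-1` N) by move=> wN; exists N.
have Gh h : sval h @ G --> w h.
  by move=> U /eval_cvg /= /GN.
exists G; split => //.
  apply: filter_from_proper => N /clw[_ [[x _ <-] Nx]]; by exists x.
move=> Q [rho _ rhoQ]; apply: filterS rhoQ _.
pose K := (X * higson_fun d)%type.
(* Half the separation, so no value is within [gap] of both the base value and [w]. A pair with gap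
   0 contributes the empty set. *)
pose gap (i : K) : R := `|sval i.2 i.1 - w i.2| / 2.
have [|x xrho|m [g hg]] := @hp x0 rho K
    (fun i => [set y | `|sval i.2 i.1 - sval i.2 y| < gap i]).
- move=> [x h] y /= hy; have [_ hc _] := proj2_sig h.
  have e0 : 0 < gap (x, h) - `|sval h x - sval h y| by rewrite subr_gt0.
  have [del del0 hdel] := hc y I _ e0; exists del => // z /(hdel z I) hz.
  have := ler_distD (sval h y) (sval h x) (sval h z); lra.
- have [h hh] : exists h, sval h x <> w h.
    by apply: contra_notP nw => /forallNP nh; exists x => //;
      apply/funext => h; apply: contrapT; exact: nh.
  exists (x, h) => //=; rewrite subrr normr0 /gap divr_gt0 //= normr_gt0 subr_eq0.
  exact/eqP.
have : \forall y \near G, forall j,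
    ~ `|sval (g j).2 (g j).1 - sval (g j).2 y| < gap (g j).
  apply: filter_forall => j; have [g0|g0] := ltP 0 (gap (g j)); last first.
    apply: (@filterS _ G _ setT) => [y _|]; last exact: filterT.
    by apply/negP; rewrite -leNgt; exact: le_trans g0 (normr_ge0 _).
  have /cvgrPdist_lt/(_ _ g0) := Gh (g j).2; apply: filterS => y hy.
  have := ler_distD (sval (g j).2 y) (sval (g j).2 (g j).1) (w (g j).2).
  rewrite (distrC (sval (g j).2 y) (w _)) /gap => h1 h2.
  by move: hy h2; rewrite /gap /=; lra.
apply: filterS => y hy; rewrite /= ltNge; apply/negP => /hg[j _ /=].
exact: hy.
Qed.

Lemma corona_closed : closed (higson_corona d : set T).
Proof.
move=> w clw; split.
  by apply: closed_closure => N /clw[v [[vc _] Nv]]; exists v.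
move=> [x _ xw]; have h1 := @eval_cvg (bump x) w.
have w1 : w (bump x) = 1.
  by rewrite -xw /higson_map /= distxx subr0 /Num.max ltr01.
move/cvgrPdist_lt : h1 => /(_ _ ltr01) /clw[v [/corona_escapes_to[G [PG farG Gv]]]].
rewrite /= w1 => h; have h0 : sval (bump x) @ G --> (0 : R) by exact: bump_far.
have v0 : v (bump x) = 0 by exact: cvg_unique (Gv (bump x)) h0.
by move: h; rewrite v0 subr0 normr1 ltxx.
Qed.

(** Bounded functions converge along an ultrafilter, and the limits of all Higson functions are the
    coordinates of [w]. *)
Lemma ultra_escapes_to (G : set_system X) : UltraFilter G -> far `<=` G ->
  exists2 w, higson_corona d w & escapes_to G w.
Proof.
move=> GU farG.
have hlim (h : higson_fun d) : exists l : R, sval h @ G --> l.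
  have [[M hM] _ _] := proj2_sig h.
  by apply: (@ultra_bounded_cvg _ _ _ _ M); exact: filterE.
have [w hw] := choice hlim; have ew : escapes_to G w.
  by split => //; exact: ultra_proper.
by exists w => //; exact: escapes_to_corona ew.
Qed.

Lemma escape_cluster (F : set_system X) : ProperFilter F -> far `<=` F ->
  exists w G, [/\ higson_corona d w, escapes_to G w & F `<=` G].
Proof.
move=> PF farF; have [G [GU FG]] := ultraFilterLemma PF.
have [w cw ew] := ultra_escapes_to GU (subset_trans farF FG).
by exists w, G.
Qed.

Lemma corona_le w (f g : higson_fun d) : higson_corona d w ->
  (\forall x \near far, sval f x <= sval g x) -> w f <= w g.
Proof.
move=> /corona_escapes_to[G [PG farG Gw]] /farG fg.
rewrite -subr_ge0; apply: (@ler_cvg_to _ ((fun x => sval g x - sval f x) @ G)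
  _ _ (cst 0) id); first exact: cvg_cst.
- exact: cvgB (Gw g) (Gw f).
- by apply: (@filterS _ G _ _ _ _ fg) => x /=; rewrite subr_ge0.
Qed.

Lemma corona_cst w c (f : higson_fun d) : higson_corona d w ->
  (forall x, sval f x = c) -> w f = c.
Proof.
move=> /corona_escapes_to[G [PG farG Gw]] fc.
by apply: (cvg_unique _ (Gw f)) => //; rewrite (funext fc); exact: cvg_cst.
Qed.

Lemma corona_lb w (f : higson_fun d) c : higson_corona d w ->
  (\forall x \near far, c <= sval f x) -> c <= w f.
Proof.
move=> cw cf; have hc := higson_cst hd hp x0 c.
by rewrite -(@corona_cst w c (exist _ _ hc)) //; exact: corona_le.
Qed.

Lemma corona_ub w (f : higson_fun d) c : higson_corona d w ->
  (\forall x \near far, sval f x <= c) -> w f <= c.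
Proof.
move=> cw cf; have hc := higson_cst hd hp x0 c.
by rewrite -(@corona_cst w c (exist _ _ hc)) //; exact: corona_le.
Qed.

(** On the corona each coordinate is bounded, so an ultrafilter converges coordinatewise, and the
    limit stays in the closed corona. *)
Lemma corona_compact : compact (higson_corona d : set T).
Proof.
rewrite compact_ultra => F FU Fc.
have hlim (h : higson_fun d) : exists l : R, (fun v : T => v h) @ F --> l.
  have [[M hM] _ _] := proj2_sig h.
  apply: (@ultra_bounded_cvg _ _ _ _ M) => //; apply: filterS Fc => v cv /=.
  rewrite ler_norml; apply/andP; split; [apply: corona_lb|apply: corona_ub] => //;
    by apply: filterE => x; have := hM x; rewrite ler_norml => /andP[].
have [w hw] := choice hlim; have Fw : F --> (w : T) by exact/cvg_ptws.
exists w; split => //; apply: corona_closed => B /Fw FB.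
by have [v []] := filter_ex (filterI Fc FB); exists v.
Qed.

Lemma corona_mul w (f g h : higson_fun d) : higson_corona d w ->
  (forall x, sval h x = sval f x * sval g x) -> w h = w f * w g.
Proof.
move=> /corona_escapes_to[G [PG farG Gw]] hfg.
apply: (cvg_unique _ (Gw h)) => //; rewrite (funext hfg).
exact: cvgM.
Qed.

Lemma corona_sum w (I : Type) (s : seq I) (P : pred I) (f : I -> higson_fun d)
    (h : higson_fun d) : higson_corona d w ->
  (forall x, sval h x = \sum_(i <- s | P i) sval (f i) x) ->
  w h = \sum_(i <- s | P i) w (f i).
Proof.
move=> /corona_escapes_to[G [PG farG Gw]] hf.
apply: (cvg_unique _ (Gw h)) => //; rewrite (funext hf).
by apply: filter_cvg_sum => i; exact: Gw.
Qed.

(* The sets [{v | 0 < v q}] with [q >= 0] form a basis of neighbourhoods in the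
   corona: they generate a filter that converges coordinatewise. *)
Lemma corona_urysohn (U : set T) w : nbhs w U -> higson_corona d w ->
  exists q : higson_fun d, [/\ forall x, 0 <= sval q x, 0 < w q &
    forall v, higson_corona d v -> 0 < v q -> U v].
Proof.
move=> wU cw.
pose F : set_system T := [set S | exists q : higson_fun d,
  [/\ forall x, 0 <= sval q x, 0 < w q &
    forall v, higson_corona d v -> 0 < v q -> S v]].
suff : F --> w by exact.
have FF : Filter F.
  split.
  - have h1 : higson d (fun=> 1 : R) by exact: higson_cst.
    exists (exist _ _ h1); split => //.
    by rewrite (@corona_cst w 1) // ltr01.
  - move=> A B [q [q0 qw qA]] [r [r0 rw rB]].
    have hqr := higsonM hd hp x0 (proj2_sig q) (proj2_sig r).
    have qrE v : higson_corona d v -> v (exist _ _ hqr) = v q * v r.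
      by move=> cv; exact: corona_mul.
    exists (exist _ _ hqr); split.
    + by move=> x /=; rewrite mulr_ge0.
    + by rewrite qrE // mulr_gt0.
    + move=> v cv; rewrite qrE // => qr.
      have vq : 0 <= v q by apply: corona_lb => //; exact: filterE.
      have vr : 0 <= v r by apply: corona_lb => //; exact: filterE.
      move: qr; rewrite lt_neqAle eq_sym mulf_eq0 negb_or => /andP[/andP[a b] _].
      by split; [apply: qA|apply: rB] => //; rewrite lt_neqAle eq_sym ?a ?b.
  - move=> A B AB [q [q0 qw qA]]; exists q; split => // v cv vq.
    by apply: AB; exact: qA.
apply/cvg_ptws => h; apply/cvgrPdist_lt => e e0.
(* A hat about the value [w h]: at a point [v] of the corona it is positive exactly when
   [|w h - v h| < e]. *)
have hf : higson d (fun x => Num.max 0 (e - `|w h - sval h x|)).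
  apply: higson_max => //; first exact: higson_cst.
  apply: higsonB => //; first exact: higson_cst.
  apply: higson_norm => //; apply: higsonB => //; first exact: higson_cst.
  exact: (proj2_sig h).
have hfE v : higson_corona d v -> v (exist _ _ hf) = Num.max 0 (e - `|w h - v h|).
  move=> /corona_escapes_to[G [PG farG Gw]].
  apply: (cvg_unique _ (Gw _)) => //=; rewrite maxr_absE.
  under eq_fun do rewrite maxr_absE.
  have Gh : (e - `|w h - sval h x|) @[x --> G] --> e - `|w h - v h|.
    apply: cvgB; first exact: cvg_cst.
    by apply: cvg_norm; apply: cvgB => //; exact: cvg_cst.
  apply: cvgM; last exact: cvg_cst.
  apply: cvgD; first by apply: cvgD => //; exact: cvg_cst.
  by apply: cvg_norm; apply: cvgB => //; exact: cvg_cst.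
exists (exist _ _ hf); split.
- by move=> x /=; rewrite le_max lexx.
- by rewrite hfE // subrr normr0 subr0 lt_max e0 orbT.
- by move=> v cv; rewrite hfE // lt_max ltxx /= subr_gt0.
Qed.

End Corona.

(** * Finite covers of the corona *)

Section CoronaCovers.
Variables (R : realType) (X : Type) (d : X -> X -> R).
Hypothesis hd : is_metric d.
Hypothesis hp : proper_metric d.
Variable x0 : X.
Local Notation far := (far d x0).
Local Notation T := {ptws higson_fun d -> (R : topologicalType)}.

Lemma open_eval (h : higson_fun d) (A : set R) : open A ->
  open [set v : T | A (v h)].
Proof.
move=> oA; apply: (@open_comp T R (fun v => v h) A) => // v _.
exact: eval_cvg.
Qed.

Lemma open_eval_gt0 (h : higson_fun d) : open [set v : T | 0 < v h].
Proof. by apply: (@open_eval h [set x | 0 < x]); exact: open_gt. Qed.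

(** Compactness selects finitely many functions given by [corona_urysohn], and [p i] adds those
    assigned to [U i]. The total is positive on the corona but not normalised to 1. *)
Lemma corona_partition m (U : 'I_m -> set T) :
  (forall i, open (U i)) -> higson_corona d `<=` \bigcup_i U i ->
  exists p : 'I_m -> higson_fun d,
    [/\ forall i x, 0 <= sval (p i) x,
        forall i w, higson_corona d w -> 0 < w (p i) -> U i w &
        forall w, higson_corona d w -> exists i, 0 < w (p i)].
Proof.
move=> oU cU.
(* [None] is the dummy index off the corona, since ['I_m] may be empty. *)
have hq (w : T) : exists iq : option 'I_m * higson_fun d, higson_corona d w ->
    exists2 i, iq.1 = Some i & [/\ forall x, 0 <= sval iq.2 x, 0 < w iq.2 &
      forall v, higson_corona d v -> 0 < v iq.2 -> U i v].
  have [cw|ncw] := pselect (higson_corona d w); last first.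
    by exists (None, exist _ _ (higson_cst hd hp x0 0)).
  have [i _ Uw] := cU w cw.
  have wU : nbhs w (U i) by apply: open_nbhs_nbhs.
  have [q hq] := corona_urysohn hd hp x0 wU cw.
  by exists (Some i, q) => _; exists i.
have [iq hiq] := choice hq.
have [||k [g [cg gcov]]] := @compact_finite_subcover _ _ _ (higson_corona d)
    (fun w : T => [set v : T | 0 < v (iq w).2]) (corona_compact hd hp x0).
- by move=> w _; exact: open_eval_gt0.
- by move=> w cw; exists w => //; have [i _ []] := hiq w cw.
pose s i x : R := \sum_(j < k | (iq (g j)).1 == Some i) sval (iq (g j)).2 x.
have hs i : higson d (s i).
  by apply: (higson_sum hd hp x0) => j; exact: (proj2_sig (iq (g j)).2).
have s0 i x : 0 <= s i x.
  by apply: sumr_ge0 => j _; have [? _ [h _ _]] := hiq (g j) (cg j).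
have sE i w : higson_corona d w ->
    w (exist _ _ (hs i)) = \sum_(j < k | (iq (g j)).1 == Some i) w (iq (g j)).2.
  by move=> cw; exact: (corona_sum hp x0 cw).
have w0 w j : higson_corona d w -> 0 <= w (iq (g j)).2.
  move=> cw; apply: (corona_lb (x0 := x0) hd hp cw).
  by apply: filterE => x; have [? _ [h _ _]] := hiq (g j) (cg j).
exists (fun i => exist _ _ (hs i)); split => //.
- move=> i w cw; rewrite sE // => h.
  have [j ij wj] : exists2 j, (iq (g j)).1 = Some i & 0 < w (iq (g j)).2.
    apply: contrapT => nj; move: h; rewrite big1 ?ltxx // => j /eqP ij.
    apply/eqP; rewrite eq_le w0 // andbT leNgt; apply/negP => wj.
    by apply: nj; exists j.
  have [i' ij' [_ _ hU]] := hiq (g j) (cg j).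
  by move: ij'; rewrite ij => -[->]; exact: hU.
- move=> w cw; have [j _ /= wj] := gcov w cw.
  have [i ij _] := hiq (g j) (cg j).
  exists i; rewrite sE // (bigD1 j) /=; last exact/eqP.
  by rewrite ltr_pwDl // sumr_ge0 // => j' _; exact: w0.
Qed.

(** Otherwise the sets where [f < e] far out generate a proper escaping filter, and a corona point
    [w] adherent to it has [w f <= 0]. *)
Lemma corona_gt0_far (f : higson_fun d) :
  (forall w, higson_corona d w -> 0 < w f) ->
  exists2 e : R, 0 < e & \forall x \near far, e <= sval f x.
Proof.
move=> f0; apply: contrapT => nf.
pose F := filter_from [set re : R * R | 0 < re.2]
  (fun re => [set x | re.1 < d x0 x /\ sval f x < re.2]).
have FF : Filter F.
  apply: filter_from_filter; first by exists (0, 1) => /=.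
  move=> [r e] [r' e'] /= e0 e'0.
  exists (Num.max r r', Num.min e e') => /=; first by rewrite lt_min e0.
  by move=> x [/=]; rewrite gt_max lt_min => /andP[? ?] /andP[].
have PF : ProperFilter F.
  apply: filter_from_proper => -[r e] /= e0; apply: contrapT => nx.
  apply: nf; exists e => //; exists r => // x /= rx; rewrite leNgt.
  by apply/negP => fx; apply: nx; exists x.
have farF : far `<=` F.
  by move=> Q [r _ rQ]; exists (r, 1) => //= x [/rQ].
have [w [G [cw [PG _ Gw] FG]]] := escape_cluster hd hp PF farF.
have wf := f0 w cw; have e0 : 0 < w f / 2 by lra.
have /cvgrPdist_lt/(_ _ e0) G1 := Gw f.
have G2 : G [set x | sval f x < w f / 2].
  by apply: FG; exists (0, w f / 2) => // x [].
have [x [/= h1 h2]] := filter_ex (filterI G1 G2).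
by move: h1; rewrite ltr_norml; lra.
Qed.

End CoronaCovers.

(* Shrinking [n + 2] chosen members at a time to have empty intersection, the
   other members being lumped with the last chosen one. *)
Lemma covdim_le_shrink (T : topologicalType) (S : set T) (n : nat) :
  (forall U : 'I_n.+2 -> set T, (forall i, open (U i)) -> S `<=` \bigcup_i U i ->
    exists V : 'I_n.+2 -> set T,
      [/\ forall i, open (V i), S `<=` \bigcup_i V i,
          forall i, V i `&` S `<=` U i &
          forall x, S x -> ~ forall i, V i x]) ->
  covdim_le S n.
Proof.
move=> H k U oU cU.
have step (V : 'I_k -> set T) (e : {ffun 'I_n.+2 -> 'I_k}) : injective e ->
    (forall i, open (V i)) -> S `<=` \bigcup_i V i ->
    exists V' : 'I_k -> set T,
      [/\ forall i, open (V' i), S `<=` \bigcup_i V' i,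
          forall i, V' i `<=` V i & forall x, S x -> ~ forall i, V' (e i) x].
  move=> ei oV cV.
  pose rest := \bigcup_(j in [set j | forall i, e i != j]) V j.
  pose W0 i := if i == ord_max then V (e i) `|` rest else V (e i).
  have [||W [oW cW WV Wn]] := H W0.
  - move=> i; rewrite /W0; case: ifP => // _; apply: openU => //.
    exact: bigcup_open.
  - move=> x Sx; have [j _ Vj] := cV x Sx.
    have [[i ij]|nij] := pselect (exists i, e i = j).
      by exists i => //; rewrite /W0; case: ifP => _; [left|]; rewrite ij.
    exists ord_max => //; rewrite /W0 eqxx; right; exists j => // i.
    by apply/eqP => ij; apply: nij; exists i.
  pose V' j := if [pick i | e i == j] is Some i then V j `&` W i else V j.
  have V'e i : V' (e i) = V (e i) `&` W i.
    rewrite /V'; case: pickP => [i' /eqP/ei -> //|/(_ i)].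
    by rewrite eqxx.
  exists V'; split.
  - by move=> j; rewrite /V'; case: pickP => // i _; exact: openI.
  - move=> x Sx; have [i _ Wi] := cW x Sx.
    have W0x : W0 i x by exact: WV.
    have [Vx|nVx] := pselect (V (e i) x).
      by exists (e i) => //; rewrite V'e.
    move: W0x; rewrite /W0; case: ifP => // _ [//|[j /= hj Vj]].
    by exists j => //; rewrite /V'; case: pickP => // i'; rewrite (negbTE (hj i')).
  - by move=> j; rewrite /V'; case: pickP => [i _|_] x // [].
  - by move=> x Sx h; apply: (Wn x Sx) => i; have := h i; rewrite V'e => -[].
have [V [oV cV VU Vn]] : exists V : 'I_k -> set T,
    [/\ forall i, open (V i), S `<=` \bigcup_i V i, forall i, V i `<=` U i &
        forall e : {ffun 'I_n.+2 -> 'I_k}, e \in enum {ffun 'I_n.+2 -> 'I_k} ->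
          injective e -> forall x, S x -> ~ forall i, V (e i) x].
  (* The choices [e] of [n + 2] members are treated one after another; later shrinkings keep the
     intersections already emptied empty. *)
  elim: (enum _) => [|e s [V [oV cV VU Vn]]].
    by exists U; split => // i x.
  have [ei|nei] := pselect (injective e); last first.
    exists V; split => // e'; rewrite inE => /orP[/eqP -> //|]; exact: Vn.
  have [V' [oV' cV' V'V V'n]] := step V e ei oV cV.
  exists V'; split => // [i x /V'V/VU //|e']; rewrite inE => /orP[/eqP -> _ //|].
  move=> e's e'i x Sx h; apply: (Vn e' e's e'i x Sx) => i; exact: V'V.
exists k, V; split => // [i|x Sx J VJ].
  by exists i => x [/VU Ux Sx].
rewrite leqNgt; apply/negP => ltJ.
pose e := [ffun i : 'I_n.+2 => enum_val (widen_ord ltJ i)].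
apply: (Vn e _ _ x Sx); first by rewrite mem_enum.
- by move=> i j; rewrite !ffunE => /enum_val_inj/(congr1 val) /= ij; exact: val_inj.
- by move=> i; rewrite ffunE; apply: VJ; exact: enum_valP.
Qed.

(** * Points in general position *)

Lemma exists_nonroot (R : realFieldType) (p : {poly R}) (delta : R) :
  p != 0 -> 0 < delta -> exists t, [/\ 0 < t, t <= delta & ~~ root p t].
Proof.
(* These [size p] distinct candidates outnumber the roots of [p]. *)
move=> p0 d0; pose s := [seq delta / k.+1%:R | k <- iota 0 (size p)].
have us : uniq s.
  rewrite map_inj_uniq ?iota_uniq // => i j /(mulfI (lt0r_neq0 d0)).
  by move/invr_inj/eqP; rewrite eqr_nat eqSS => /eqP.
have [/(max_poly_roots p0)|] := boolP (all (root p) s).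
  by move=> /(_ us); rewrite size_map size_iota ltnn.
move=> /allPn[t /mapP[k _ ->] nr]; exists (delta / k.+1%:R); split => //.
  by rewrite divr_gt0 ?ltr0n.
by rewrite ler_pdivrMr ?ltr0n // ler_peMr ?ler1n // ltW.
Qed.

(* The points are moved along the moment curve; only finitely many parameters
   are bad because [det (A + t V)] is, up to a unit, a characteristic
   polynomial when [V] is an invertible Vandermonde matrix. *)
Lemma general_position (R : realFieldType) (N m : nat) (a : 'I_m -> 'rV[R]_N)
    (delta : R) : 0 < delta ->
  exists c : 'I_m -> 'rV[R]_N,
    (forall i j, `|c i ord0 j - a i ord0 j| <= delta) /\
    forall (J : {set 'I_m}) (w : 'I_m -> R), (#|J| <= N)%N ->
      \sum_(i in J) w i *: c i = 0 -> forall i, i \in J -> w i = 0.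
Proof.
(* The [N] extra indices complete any [J] of at most [N] elements to an injective [N]-tuple, so that
   only square matrices occur. *)
move=> d0; pose K := ('I_m + 'I_N)%type.
pose b (k : K) : 'rV[R]_N := if k is inl i then a i else 0.
pose s (k : K) : R := (enum_rank k)%:R / #|{: K}|%:R.
have s01 k : 0 <= s k <= 1.
  have K0 : (0 < #|{: K}|)%N by apply/card_gt0P; exists k.
  rewrite divr_ge0 ?ler0n //= ler_pdivrMr ?ltr0n // mul1r ler_nat.
  exact/ltnW/ltn_ord.
have s_inj : injective s.
  move=> k l kl; have K0 : (0 < #|{: K}|)%N by apply/card_gt0P; exists k.
  have Kn0 : (#|{: K}|%:R : R)^-1 != 0 by rewrite invr_neq0 // pnatr_eq0 -lt0n.
  move/(mulIf Kn0)/eqP : kl; rewrite eqr_nat => /eqP/val_inj.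
  exact: enum_rank_inj.
pose v (k : K) : 'rV[R]_N := \row_j s k ^+ j.
pose A (e : {ffun 'I_N -> K}) := \matrix_i b (e i).
pose V (e : {ffun 'I_N -> K}) := \matrix_i v (e i).
pose B e := - (A e *m invmx (V e)).
(* One [t] must serve all tuples: if a nonzero [u] kills [A e + t V e] with [V e] invertible, then
   [t] is an eigenvalue of [B e]. *)
have p0 : \prod_e char_poly (B e) != 0.
  by apply/prodf_neq0 => e _; exact/monic_neq0/char_poly_monic.
have [t [t0 td nroot]] := exists_nonroot p0 d0.
pose c k := b k + t *: v k.
have Vunit (e : {ffun 'I_N -> K}) : injective e -> V e \in unitmx.
  move=> ei.
  have -> : V e = (Vandermonde N (\row_i s (e i)))^T.
    by apply/matrixP => i j; rewrite !mxE.
  rewrite unitmx_tr unitmxE det_Vandermonde unitfE.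
  apply/prodf_neq0 => i _; apply/prodf_neq0 => j ij.
  rewrite !mxE subr_eq0; apply: contraTneq ij => /s_inj/ei ->.
  by rewrite ltnn.
have free (e : {ffun 'I_N -> K}) (u : 'rV[R]_N) : injective e ->
    u *m (\matrix_i c (e i)) = 0 -> u = 0.
  move=> ei; have -> : \matrix_i c (e i) = A e + t *: V e.
    by apply/matrixP => i j; rewrite !mxE.
  rewrite mulmxDr -scalemxAr => /eqP; rewrite addrC addr_eq0 => /eqP uV.
  apply: contraNeq nroot => u0; rewrite (bigD1 e) //= rootM; apply/orP; left.
  rewrite -eigenvalue_root_char; apply/eigenvalueP; exists u => //.
  by rewrite mulmxN mulmxA -mulNmx -uV -scalemxAl mulmxK ?Vunit.
exists (c \o inl); split.
  move=> i j; rewrite !mxE /= addrAC subrr add0r normrM ger0_norm; last exact: ltW.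
  have /andP[s0 s1] := s01 (inl i).
  rewrite normrX ger0_norm //; apply: le_trans td.
  by rewrite ler_piMr ?exprn_ile1 // ltW.
move=> J w JN sum0 i0 i0J.
pose o (k : nat) : option 'I_#|J| := insub k.
pose e := [ffun i : 'I_N => if o i is Some i' then inl (enum_val i') else inr i : K].
pose u := \row_(i < N) (if o i is Some i' then w (enum_val i') else 0).
have ei : injective e.
  move=> i j; rewrite !ffunE /o; case: insubP => [i' _ ii'|_]; case: insubP => [j' _ jj'|_] //.
    by move=> [/enum_val_inj ij]; apply: val_inj; rewrite /= -ii' -jj' ij.
  by move=> [].
have u0 : u = 0.
  apply: (free e) => //; apply: etrans sum0; rewrite mulmx_sum_row [RHS]big_enum_val /=.
  pose F k := if o k is Some i' then w (enum_val i') *: c (inl (enum_val i')) else 0.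
  rewrite [LHS](eq_bigr (fun i : 'I_N => F i)); last first.
    by move=> i _; rewrite rowK mxE ffunE /F; case: (o i) => // ; rewrite scale0r.
  rewrite [RHS](eq_bigr (fun i : 'I_#|J| => F i)); last first.
    by move=> i _; rewrite /F /o valK.
  rewrite (big_ord_widen _ F JN) [RHS]big_mkcond; apply: eq_bigr => i _.
  by rewrite /F /o; case: insubP => [k -> _|/negbTE ->].
have /rowP/(_ (widen_ord JN (enum_rank_in i0J i0))) := u0.
by rewrite !mxE /o /= valK enum_rankK_in.
Qed.

(** * Maps to Euclidean space *)

Section Euclidean.
Variables (R : realType) (m : nat).
Implicit Types u v : 'rV[R]_m.

(** Equivalent to the Euclidean norm, and preferred because sums of absolute values stay within
    Higson functions and within asymptotically Lipschitz ones. *)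
Definition l1norm v : R := \sum_i `|v ord0 i|.

Lemma l1norm_ge0 v : 0 <= l1norm v. Proof. exact: sumr_ge0. Qed.

Lemma coord_le_l1norm v i : `|v ord0 i| <= l1norm v.
Proof. by rewrite /l1norm (bigD1 i) //= lerDl sumr_ge0. Qed.

Lemma l1norm_lipschitz u v : `|l1norm u - l1norm v| <= l1norm (u - v).
Proof.
rewrite /l1norm -sumrB; apply: le_trans (ler_norm_sum _ _ _) _.
apply: ler_sum => i _; rewrite !mxE; exact: ler_dist_dist.
Qed.

Lemma coord_le_eucl u v i : `|u ord0 i - v ord0 i| <= eucl u v.
Proof.
rewrite -sqrtr_sqr; apply: ler_wsqrtr; rewrite (bigD1 i) //= lerDl.
by apply: sumr_ge0 => j _; exact: sqr_ge0.
Qed.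

Lemma l1norm_le_eucl u v : l1norm (u - v) <= m%:R * eucl u v.
Proof.
apply: le_trans (_ : \sum_(i < m) eucl u v <= _).
  by apply: ler_sum => i _; rewrite !mxE; exact: coord_le_eucl.
by rewrite sumr_const card_ord mulr_natl.
Qed.

Lemma eucl_le_l1norm u v : eucl u v <= l1norm (u - v).
Proof.
rewrite -(ger0_norm (l1norm_ge0 (u - v))) -sqrtr_sqr; apply: ler_wsqrtr.
rewrite expr2 {1}/l1norm mulr_suml; apply: ler_sum => i _.
rewrite -normr_id -real_normK ?num_real // expr2.
rewrite (_ : u ord0 i - v ord0 i = (u - v) ord0 i); last by rewrite !mxE.
by rewrite normr_id; apply: ler_wpM2l => //; exact: coord_le_l1norm.
Qed.

Lemma mopen_eucl_open (U : set 'rV[R]_m) : mopen (@eucl R m) U -> open U.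
Proof.
move=> oU; rewrite openE => x Ux; have [e e0 he] := oU x Ux.
apply/nbhs_ballP; exists (e / m.+1%:R) => /=; first by rewrite divr_gt0 ?ltr0n.
move=> y [_ xy]; apply: he; apply: le_lt_trans (eucl_le_l1norm x y) _.
apply: le_lt_trans (_ : \sum_(i < m) e / m.+1%:R < e).
  by apply: ler_sum => i _; rewrite !mxE; apply: ltW; exact: xy.
rewrite sumr_const card_ord -[X in X < _]mulr_natl mulrCA gtr_pMr //.
by rewrite ltr_pdivrMr ?ltr0n // mul1r ltr_nat.
Qed.

Lemma mcompact_cube (M : R) :
  mcompact (@eucl R m) [set v | forall i, `|v ord0 i| <= M].
Proof.
move=> I U oU cU.
have cC : compact [set v : 'rV[R]_m | forall i, `[-M, M]%classic (v ord0 i)].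
  by apply: (@rV_compact _ _ (fun=> `[-M, M]%classic)) => i; exact: segment_compact.
have [||k [g [_ hg]]] := @compact_finite_subcover _ _ {classic I} setT U cC.
- by move=> i _; exact: mopen_eucl_open.
- move=> v hv; have [|i _ Ui] := cU v; last by exists i.
  by move=> i; have := hv i; rewrite /= in_itv /= ler_norml.
exists k, g => v hv; apply: hg => i.
by have := hv i; rewrite /= in_itv /= ler_norml.
Qed.

End Euclidean.

Lemma mcompact_pos (R : realType) (T : Type) (d : T -> T -> R) (K : set T)
    (g : T -> R) : mcompact d K -> mcont_on d (@rdist R) setT g ->
  (forall v, K v -> 0 < g v) -> exists2 e, 0 < e & forall v, K v -> e <= g v.
Proof.
move=> cK gc g0.
have [||k [h hh]] := cK nat (fun k => [set v | k.+1%:R^-1 < g v]).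
- move=> k v /=; move: (k.+1%:R^-1) => c kv; have e0 : 0 < g v - c by rewrite subr_gt0.
  have [del del0 H] := gc v I _ e0; exists del => // w /(H w I).
  rewrite /rdist /= ltr_norml => /andP[]; lra.
- move=> v /g0 gv; have gi : 0 < (g v)^-1 by rewrite invr_gt0.
  exists (Num.bound (g v)^-1) => //=.
  rewrite -[ltRHS]invrK ltf_pV2 ?posrE ?ltr0n //.
  by apply: lt_trans (archi_boundP (ltW gi)) _; rewrite ltr_nat.
(* A finite product of factors in [[0, 1]] lies below each factor. *)
exists (\prod_(j < k) (h j).+1%:R^-1).
  by apply: prodr_gt0 => j _; rewrite invr_gt0 ltr0n.
move=> v /hh [j _ /=] /ltW; apply: le_trans; rewrite (bigD1 j) //=.
rewrite ler_piMr ?invr_ge0 ?ler0n //; apply: prodr_ile1 => i.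
by rewrite invr_ge0 ler0n /= invf_le1 ?ltr0n // ler1n.
Qed.

Lemma mcompact_closed_sub (R : realType) (T : Type) (d : T -> T -> R)
    (C B : set T) : mcompact d C -> mclosed d B -> B `<=` C -> mcompact d B.
Proof.
move=> cC clB BC I U oU cU.
have [[i0 _]|nI] := pselect (exists i : I, True); last first.
  have g (j : 'I_0) : I by case: j.
  by exists 0%N, g => x /cU[i]; case: nI; exists i.
have [||m [g hg]] := cC (option I) (fun o => if o is Some i then U i else ~` B).
- by case.
- move=> x Cx; have [/cU[i _ Ui]|nBx] := pselect (B x); first by exists (Some i).
  by exists None.
(* [None] covers no point of [B], so it may be replaced by an arbitrary index. *)
exists m, (fun j => odflt i0 (g j)) => x Bx.
by have [j _] := hg x (BC x Bx); case E : (g j) => [i|//] Ui; exists j; rewrite ?E.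
Qed.

Section VectorMaps.
Variables (R : realType) (X : Type) (d : X -> X -> R) (m : nat).
Hypothesis hd : is_metric d.
Hypothesis hp : proper_metric d.
Variable x0 : X.
Local Notation far := (far d x0).
Implicit Types (A : set X) (f : X -> 'rV[R]_m).

Lemma mcont_coordP A f : mcont_on d (@eucl R m) A f <->
  forall i, mcont_on d (@rdist R) A (fun x => f x ord0 i).
Proof.
split=> [fc i x Ax e e0|fc x Ax e e0].
  have [del del0 h] := fc x Ax e e0; exists del => // y Ay xy.
  exact: le_lt_trans (coord_le_eucl _ _ _) (h y Ay xy).
have e1 : 0 < e / m.+1%:R by rewrite divr_gt0 ?ltr0n.
have : \forall y \near mnbhs d A x, forall i, `|f x ord0 i - f y ord0 i| < e / m.+1%:R.
  apply: filter_forall => i.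
  by have /cvgrPdist_lt/(_ _ e1) := mcont_cvg (fc i) Ax.
move=> [del del0 h]; exists del => // y Ay xy.
apply: le_lt_trans (eucl_le_l1norm _ _) _.
apply: le_lt_trans (_ : \sum_(i < m) e / m.+1%:R < e).
  by apply: ler_sum => i _; rewrite !mxE; apply: ltW; exact: (h y (conj Ay xy)).
rewrite sumr_const card_ord -[X in X < _]mulr_natl mulrCA gtr_pMr //.
by rewrite ltr_pdivrMr ?ltr0n // mul1r ltr_nat.
Qed.

Lemma asymp_lip_coordP A f : asymp_lip_on d (@eucl R m) A f <->
  forall i, asymp_lip_on d (@rdist R) A (fun x => f x ord0 i).
Proof.
split=> [[L [s [L0 s0 h]]] i|h].
  exists L, s; split => // x y Ax Ay.
  exact: le_trans (coord_le_eucl _ _ _) (h x y Ax Ay).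
have [L hL] := choice h; have {}[s hs] := choice hL.
exists (\sum_i L i), (\sum_i s i); split.
- by apply: sumr_ge0 => i _; have [] := hs i.
- by apply: sumr_ge0 => i _; have [] := hs i.
- move=> x y Ax Ay; apply: le_trans (eucl_le_l1norm _ _) _.
  rewrite mulr_suml -big_split; apply: ler_sum => i _; rewrite !mxE.
  by have [_ _] := hs i; exact.
Qed.

Lemma mproper_far A f : mproper_on d (@eucl R m) A f ->
  forall M, \forall x \near far, A x -> M <= l1norm (f x).
Proof.
move=> fp M; have [r hr] := mcompact_bounded hd x0 (fp _ (@mcompact_cube R m M)).
exists r => // x /= rx Ax; rewrite leNgt; apply/negP => fM.
have : d x0 x <= r.
  apply: hr; split => // i; apply: le_trans (coord_le_l1norm _ _) _; exact: ltW.
by rewrite leNgt rx.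
Qed.

(** Converse of [mproper_far]: growth of the norm confines the preimage of [K] to a ball, and this
    preimage is closed. *)
Lemma far_mproper A f : mclosed d A -> mcont_on d (@eucl R m) A f ->
  (forall M, \forall x \near far, A x -> M <= l1norm (f x)) ->
  mproper_on d (@eucl R m) A f.
Proof.
move=> clA fc fM K cK.
have l1c (p : 'rV[R]_m) : mcont_on (@eucl R m) (@rdist R) setT (fun v => l1norm (v - p)).
  move=> v _ e e0; exists (e / m.+1%:R); first by rewrite divr_gt0 ?ltr0n.
  move=> w _ vw; apply: le_lt_trans (l1norm_lipschitz _ _) _.
  rewrite opprB addrA subrK; apply: le_lt_trans (l1norm_le_eucl _ _) _.
  have em : m%:R * eucl v w <= m.+1%:R * eucl v w.
    by rewrite ler_wpM2r ?sqrtr_ge0 // ler_nat.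
  by apply: le_lt_trans em _; rewrite mulrC -ltr_pdivlMr ?ltr0n.
(* A positive lower bound for [1 / (1 + l1norm v)] bounds the norm on [K]. Below, a lower bound for
   the distance to [f x] shows that [K] is closed. *)
have [e e0 he] : exists2 e, 0 < e & forall v, K v -> e <= (1 + l1norm v)^-1.
  apply: (mcompact_pos cK); last first.
    by move=> v _; rewrite invr_gt0; have := l1norm_ge0 v; lra.
  apply/mcontP => v _; apply: cvgV.
    by rewrite gt_eqF //; have := l1norm_ge0 v; lra.
  apply: cvgD; first exact: cvg_cst.
  have := mcont_cvg (l1c 0) (x := v) I.
  by under eq_fun do rewrite subr0; rewrite subr0.
have [r _ hr] := fM (e^-1 + 1).
apply: (mcompact_closed_sub (hp (x := x0) (r := r))).
- move=> x nAx; have [Ax|] := pselect (A x); last first.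
    by move/clA => [e' e'0 he']; exists e' => // y /he' nA [].
  have nK : ~ K (f x) by move=> Kx; apply: nAx.
  have [e' e'0 he'] : exists2 e, 0 < e & forall v, K v -> e <= l1norm (v - f x).
    apply: (mcompact_pos cK (l1c _)) => v Kv; rewrite lt_neqAle l1norm_ge0 andbT.
    apply: contra_notN nK; rewrite eq_sym psumr_eq0 // => /allP h.
    rewrite (_ : f x = v) //; apply/rowP => i; have := h i (mem_index_enum i).
    by rewrite /= normr_eq0 !mxE subr_eq0 => /eqP.
  have e1 : 0 < e' / m.+1%:R by rewrite divr_gt0 ?ltr0n.
  have [del del0 h] := fc x Ax _ e1; exists del => // y xy [Ay /= Ky].
  have := h y Ay xy; rewrite ltr_pdivlMr ?ltr0n //; apply/negP; rewrite -leNgt.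
  apply: le_trans (he' _ Ky) _.
  have -> : l1norm (f y - f x) = l1norm (f x - f y).
    by apply: eq_bigr => i _; rewrite !mxE distrC.
  apply: le_trans (l1norm_le_eucl _ _) _.
  by rewrite mulrC ler_wpM2l ?sqrtr_ge0 // ler_nat.
- move=> x [Ax /= Kx]; rewrite /Defs.closed_ball /= leNgt; apply/negP => /hr /(_ Ax).
  apply/negP; rewrite -ltNge; have := he _ Kx.
  have l0 : 0 < 1 + l1norm (f x) by have := l1norm_ge0 (f x); lra.
  by rewrite -[leLHS]invrK lef_pV2 ?posrE ?invr_gt0 //; lra.
Qed.

End VectorMaps.

(** * From the extension property to covers of the corona *)

Section ContinuousAsympLip.
Variables (R : realType) (X : Type) (d : X -> X -> R).
Hypothesis hd : is_metric d.
Hypothesis hp : proper_metric d.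
Variable x0 : X.
Local Notation dist_ge0 := (dist_ge0 hd).

Definition calip (f : X -> R) :=
  mcont_on d (@rdist R) setT f /\ asymp_lip_on d (@rdist R) setT f.

(** Products of asymptotically Lipschitz functions need not be of this kind; [calip_radial], which
    needs three arguments here, and [calip_mul_higson] are the products used. *)
Lemma calip_dominated (f g k h : X -> R) C :
  calip f -> calip g -> calip k -> 0 <= C ->
  (forall x y, `|h x - h y| <=
     C * (`|f x - f y| + `|g x - g y| + `|k x - k y|)) -> calip h.
Proof.
move=> [fc [L1 [s1 [L10 s10 fl]]]] [gc [L2 [s2 [L20 s20 gl]]]]
  [kc [L3 [s3 [L30 s30 kl]]]] C0 hC; split.
- move=> x _ e e0; have e1 : 0 < e / (3 * (C + 1)) by apply: divr_gt0 => //; lra.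
  have [d1 d10 h1] := fc x I _ e1; have [d2 d20 h2] := gc x I _ e1.
  have [d3 d30 h3] := kc x I _ e1.
  exists (Num.min d1 (Num.min d2 d3)); first by rewrite !lt_min d10 d20.
  move=> y _; rewrite !lt_min => /and3P[/(h1 y I) y1 /(h2 y I) y2 /(h3 y I) y3].
  apply: le_lt_trans (hC x y) _; move: y1 y2 y3; rewrite /rdist.
  have C1 : 0 < 3 * (C + 1) by lra.
  rewrite !ltr_pdivlMr //.
  have := normr_ge0 (f x - f y); have := normr_ge0 (g x - g y).
  have := normr_ge0 (k x - k y); lra.
- exists (C * (L1 + L2 + L3)), (C * (s1 + s2 + s3)); split.
  + by rewrite mulr_ge0 // !addr_ge0.
  + by rewrite mulr_ge0 // !addr_ge0.
  + move=> x y _ _; apply: le_trans (hC x y) _.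
    rewrite -mulrA -mulrDr; apply: ler_wpM2l => //.
    have := fl x y I I; have := gl x y I I; have := kl x y I I; rewrite /rdist; lra.
Qed.

Lemma calip_lipschitz (f : X -> R) :
  (forall x y, `|f x - f y| <= d x y) -> calip f.
Proof.
move=> fL; split; first by apply: (lipschitz_mcont hd ler01) => x y; rewrite mul1r.
by exists 1, 0; split => // x y _ _; rewrite mul1r addr0; exact: fL.
Qed.

Lemma calip_cst c : calip (fun=> c).
Proof. by apply: calip_lipschitz => x y; rewrite subrr normr0; exact: dist_ge0. Qed.

Lemma calipD f g : calip f -> calip g -> calip (fun x => f x + g x).
Proof.
move=> hf hg; apply: (calip_dominated hf hg (calip_cst 0) ler01) => x y.
rewrite subrr normr0 addr0 mul1r.
rewrite (_ : _ - _ = (f x - f y) + (g x - g y)); last by ring.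
exact: ler_normD.
Qed.

Lemma calipZ c f : calip f -> calip (fun x => c * f x).
Proof.
move=> hf.
apply: (calip_dominated hf (calip_cst 0) (calip_cst 0) (normr_ge0 c)) => x y.
by rewrite subrr normr0 !addr0 -normrM mulrBr.
Qed.

Lemma calip_norm f : calip f -> calip (fun x => `|f x|).
Proof.
move=> hf; apply: (calip_dominated hf (calip_cst 0) (calip_cst 0) ler01) => x y.
by rewrite subrr normr0 !addr0 mul1r; exact: ler_dist_dist.
Qed.

Lemma calipB f g : calip f -> calip g -> calip (fun x => f x - g x).
Proof.
move=> hf hg; under eq_fun do rewrite -mulN1r.
by apply: calipD => //; exact: calipZ.
Qed.

Lemma calip_max f g : calip f -> calip g -> calip (fun x => Num.max (f x) (g x)).
Proof.
move=> hf hg; under eq_fun do rewrite maxr_absE mulrC.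
by apply: calipZ; apply: calipD; [exact: calipD|apply: calip_norm; exact: calipB].
Qed.

Lemma calip_min f g : calip f -> calip g -> calip (fun x => Num.min (f x) (g x)).
Proof.
move=> hf hg; under eq_fun do rewrite minr_absE mulrC.
by apply: calipZ; apply: calipB; [exact: calipD|apply: calip_norm; exact: calipB].
Qed.

Lemma calip_sum (I : Type) (s : seq I) (P : pred I) (f : I -> X -> R) :
  (forall i, calip (f i)) -> calip (fun x => \sum_(i <- s | P i) f i x).
Proof.
move=> hf; elim: s => [|i s IH].
  by under eq_fun do rewrite big_nil; exact: calip_cst.
under eq_fun do rewrite big_cons; case: (P i) => //; exact: calipD.
Qed.

(** [F / m] and [rho / m] are bounded by 1, so the increment splits into those of [rho], [F] and [m]
    with coefficients bounded by 1. *)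
Lemma calip_radial (rho F m : X -> R) :
  calip rho -> calip F -> calip m -> (forall x, 1 <= m x) ->
  (forall x, `|F x| <= m x) -> (forall x, 0 <= rho x <= m x) ->
  calip (fun x => rho x / m x * F x).
Proof.
move=> hrho hF hm m1 Fm rm.
have m0 x : 0 < m x by apply: lt_le_trans (m1 x).
apply: (calip_dominated hrho hF hm ler01) => x y; rewrite mul1r.
have -> : rho x / m x * F x - rho y / m y * F y =
    F x / m x * (rho x - rho y) +
    rho y / m y * ((F x - F y) - F x / m x * (m x - m y)).
  by field; rewrite !gt_eqF.
apply: le_trans (ler_normD _ _) _; rewrite !normrM.
have q1 : `|F x| * `|(m x)^-1| <= 1.
  by rewrite normfV (gtr0_norm (m0 x)) ler_pdivrMr // mul1r.
have q2 : `|rho y| * `|(m y)^-1| <= 1.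
  have /andP[r0 r1] := rm y.
  by rewrite normfV (gtr0_norm (m0 y)) ger0_norm // ler_pdivrMr // mul1r.
have h1 := ler_wpM2r (normr_ge0 (rho x - rho y)) q1.
have h2 := ler_wpM2r (normr_ge0 (m x - m y)) q1.
have h3 := ler_normB (F x - F y) (F x / m x * (m x - m y)).
rewrite !normrM in h3.
have h4 := ler_wpM2r (normr_ge0 (F x - F y - F x / m x * (m x - m y))) q2.
by lra.
Qed.

(** The increment of [kap] is multiplied by the bounded [phi], and that of [phi] by [kap <= r],
    which the slow radius controls. *)
Lemma calip_mul_higson (kap r phi : X -> R) :
  calip kap -> higson d phi -> (forall x, 0 <= kap x <= r x) ->
  (forall x y, r x * `|phi x - phi y| <= 1 + d x y) ->
  calip (fun x => kap x * phi x).
Proof.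
move=> [kc [L [s [L0 s0 kl]]]] hphi kr rphi.
have [M M0 hM] := higson_bounded x0 hphi; have [_ pc _] := hphi; split.
- by apply/mcontP => x _; apply: cvgM; exact: mcont_cvg.
- exists (M * L + 1), (M * s + 1); split.
  + by have := mulr_ge0 M0 L0; lra.
  + by have := mulr_ge0 M0 s0; lra.
  + move=> x y _ _; rewrite /rdist.
    have -> : kap x * phi x - kap y * phi y =
      (kap x - kap y) * phi y + kap x * (phi x - phi y) by ring.
    apply: le_trans (ler_normD _ _) _; rewrite !normrM.
    have h1 := ler_wpM2l (normr_ge0 (kap x - kap y)) (hM y).
    have h2 := ler_wpM2l M0 (kl x y I I).
    have /andP[k0 k1] := kr x; rewrite (ger0_norm k0).
    have h3 := ler_wpM2r (normr_ge0 (phi x - phi y)) k1.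
    by have := rphi x y; rewrite /rdist in h2; lra.
Qed.

Lemma mcont_sub (A : set X) (f : X -> R) :
  mcont_on d (@rdist R) setT f -> mcont_on d (@rdist R) A f.
Proof.
by move=> fc x _ e e0; have [del del0 h] := fc x I e e0; exists del => // y _; exact: h.
Qed.

Lemma asymp_lip_sub (A : set X) (f : X -> R) :
  asymp_lip_on d (@rdist R) setT f -> asymp_lip_on d (@rdist R) A f.
Proof. by move=> [L [s [L0 s0 h]]]; exists L, s; split => // x y _ _; exact: h. Qed.

End ContinuousAsympLip.

(** The initial value 0 takes part in the minimum, whence the first alternative. *)
Lemma bigmin0_attained (R : realDomainType) (I : eqType) (s : seq I) (F : I -> R) :
  (\big[Num.min/0]_(i <- s) F i = 0 \/ exists i, \big[Num.min/0]_(i <- s) F i = F i)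
  /\ forall i, i \in s -> \big[Num.min/0]_(i <- s) F i <= F i.
Proof.
elim: s => [|i s [IH1 IH2]]; first by rewrite big_nil; split; [left|].
rewrite big_cons; split; last first.
  move=> j; rewrite inE => /orP[/eqP ->|/IH2 h]; first by rewrite ge_min lexx.
  by rewrite ge_min h orbT.
case: (leP (F i) (\big[Num.min/0]_(i <- s) F i)) => // _.
by right; exists i.
Qed.

Lemma exists_ge_mean (R : realDomainType) n (a : 'I_n.+1 -> R) (c : R) :
  n.+1%:R * c <= \sum_i a i -> exists i, c <= a i.
Proof.
move=> h; apply: contrapT => nc; move: h; apply/negP; rewrite -ltNge.
have -> : n.+1%:R * c = \sum_(i < n.+1) c by rewrite sumr_const card_ord mulr_natl.
apply: ltr_sum => [|i _]; last by rewrite ltNge; apply/negP => h; apply: nc; exists i.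
by apply/hasP; exists ord0; rewrite ?mem_index_enum.
Qed.

(** * Shrinking covers by extending maps *)

Section Shrinking.
Variables (R : realType) (X : Type) (d : X -> X -> R).
Hypothesis hd : is_metric d.
Hypothesis hp : proper_metric d.
Variable x0 : X.
Local Notation far := (far d x0).

(* [q = w - min w], where [w] is the direction in [R^(n+2)/R(1,...,1)] of an
   extension of [r * p] from the set where [p] is far from the diagonal. *)
Lemma dimc_shrink n (p : 'I_n.+2 -> X -> R) (e : R) :
  dimc_le d n -> (forall i, higson d (p i)) -> (forall i x, 0 <= p i x) ->
  0 < e -> (\forall x \near far, e <= \sum_i p i x) ->
  exists q : 'I_n.+2 -> X -> R,
    [/\ forall i, higson d (q i), forall x, exists i, q i x = 0,
        exists2 C, 0 <= C & \forall x \near far, forall i, q i x <= C * p i x &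
        exists2 c, 0 < c & \forall x \near far, exists i, c <= q i x].
Proof.
move=> dn hpi p0 e0 pe; pose u (j : 'I_n.+1) x := p (lift ord_max j) x - p ord_max x.
have hu j : higson d (u j) by apply: (higsonB hd hp x0).
(* A sum of at least [e] forces some [p l x >= 4 * eta], whereas off [A] any two of the [p i x]
   differ by less than [2 * eta]. *)
have [eta [eta0 etae]] : exists eta, 0 < eta /\ n.+2%:R * (4 * eta) = e.
  exists (e / (4 * n.+2%:R)); split; first by rewrite divr_gt0 // mulr_gt0 // ltr0n.
  have : n.+2%:R != 0 :> R by rewrite pnatr_eq0.
  by move: (n.+2%:R : R) => N N0; field.
pose A := [set x | exists j, eta <= `|u j x|].
have clA : mclosed d A.
  move=> x nAx.
  have : \forall y \near mnbhs d setT x, forall j, `|u j y| < eta.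
    apply: filter_forall => j; have [_ uc _] := hu j.
    have ux : `|u j x| < eta by rewrite ltNge; apply/negP => h; apply: nAx; exists j.
    have /cvgr_lt : (fun y => `|u j y|) @ mnbhs d setT x --> `|u j x|.
      by apply: cvg_norm; exact: mcont_cvg.
    exact.
  move=> [del del0 h]; exists del => // y xy [j]; rewrite leNgt => /negP; apply.
  exact: (h y (conj I xy)).
have [r [r0 r1 rinf ru]] := higson_slow_radius hd hp x0 hu.
have hru j : calip d (fun x => r x * u j x).
  apply: (calip_mul_higson x0 (r := r)) => //.
  - exact: calip_lipschitz.
  - by move=> x; rewrite r0 lexx.
pose f x : 'rV[R]_n.+1 := \row_j (r x * u j x).
have fE x j : f x ord0 j = r x * u j x by rewrite mxE.
have [|||fb [fbc fbp fbl fbA]] := dn A clA f.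
- apply/mcont_coordP => j; apply: mcont_sub; under eq_fun do rewrite fE.
  by have [] := hru j.
- apply: (far_mproper hp (x0 := x0)) => //.
    apply/mcont_coordP => j; apply: mcont_sub; under eq_fun do rewrite fE.
    by have [] := hru j.
  move=> M; near=> x => -[j hj].
  apply: le_trans (coord_le_l1norm _ j); rewrite fE normrM (ger0_norm (r0 x)).
  apply: le_trans (ler_wpM2l (r0 x) hj); rewrite -ler_pdivrMr //.
  by near: x; exact: rinf.
- apply/asymp_lip_coordP => j; apply: asymp_lip_sub; under eq_fun do rewrite fE.
  by have [] := hru j.
have hfb j : calip d (fun x => fb x ord0 j).
  by split; [move: j; apply/mcont_coordP|move: j; apply/asymp_lip_coordP].
pose m x := Num.max 1 (l1norm (fb x)).
have hm : calip d m.
  apply: (calip_max hd); first exact: calip_cst.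
  by apply: calip_sum => // j; exact: calip_norm.
have m1 x : 1 <= m x by rewrite le_max lexx.
have m0 x : 0 < m x by apply: lt_le_trans (m1 x).
have Nm x : l1norm (fb x) <= m x by rewrite le_max lexx orbT.
have fbm j x : `|fb x ord0 j| <= m x.
  exact: le_trans (coord_le_l1norm _ _) (Nm x).
have fbinf M : \forall x \near far, M <= l1norm (fb x).
  by apply: filterS (mproper_far hd x0 fbp M) => x; exact.
pose w j x := fb x ord0 j / m x.
have hw j : higson d (w j).
  have [? ?] := hfb j; have [? ?] := hm.
  apply: (higson_quotient hd hp (x0 := x0)) => // M.
  by apply: filterS (fbinf M) => x h; exact: le_trans h (Nm x).
have w1 j x : `|w j x| <= 1.
  by rewrite /w normrM normfV (gtr0_norm (m0 x)) ler_pdivrMr // mul1r.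
(* The representative in [R^(n+2)] with last coordinate 0, so that the initial value 0 of the
   minimum [mn] is one of the coordinates. *)
pose wt i x := if unlift ord_max i is Some j then w j x else 0.
have wtj j x : wt (lift ord_max j) x = w j x by rewrite /wt liftK.
have wt_max x : wt ord_max x = 0 by rewrite /wt unlift_none.
have wt1 i x : `|wt i x| <= 1.
  by rewrite /wt; case: unliftP => [j _|_] //; rewrite normr0.
have hwt i : higson d (wt i).
  rewrite /wt; case: unliftP => [j _|_] //; exact: (higson_cst hd hp x0).
pose mn x := \big[Num.min/0]_i wt i x.
have mn_le i x : mn x <= wt i x.
  by have [_] := bigmin0_attained (index_enum _) (wt ^~ x); apply; rewrite mem_index_enum.
have mn_att x : exists i, mn x = wt i x.
  have [[h|//] _] := bigmin0_attained (index_enum 'I_n.+2) (wt ^~ x).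
  by exists ord_max; rewrite wt_max.
exists (fun i x => wt i x - mn x); split.
- by move=> i; apply: (higsonB hd hp x0) => //; exact: (higson_bigmin hd hp x0).
- by move=> x; have [i ->] := mn_att x; exists i; rewrite subrr.
(* Where [p i x >= eta], the bound 2 on [q i x] is enough. Elsewhere [x] lies in [A], the extension
   is still [r * u], and [q i x <= r / m * p i x] with [r / m <= 1 / eta]. *)
- exists (2 / eta); first by rewrite divr_ge0 // ltW.
  near=> x => i; have [k ->] := mn_att x.
  have [pi|pi] := leP eta (p i x).
    have : 2 <= 2 / eta * p i x by rewrite mulrAC ler_pdivlMr // ler_wpM2l.
    by have := wt1 i x; have := wt1 k x; rewrite !ler_norml; lra.
  have [l hl] : exists l, 4 * eta <= p l x.
    by apply: exists_ge_mean; rewrite etae; near: x.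
  have Ax : A x.
    apply: contrapT => nA.
    have small j : `|p j x - p ord_max x| < eta.
      case: (unliftP ord_max j) => [j' ->|->]; last by rewrite subrr normr0.
      by rewrite ltNge; apply/negP => h; apply: nA; exists j'.
    by have := small i; have := small l; rewrite !ltr_norml; lra.
  have wtE j : wt j x = r x / m x * (p j x - p ord_max x).
    case: (unliftP ord_max j) => [j' ->|->]; last by rewrite wt_max subrr mulr0.
    by rewrite wtj /w fbA // fE mulrAC.
  rewrite !wtE -mulrBr opprB addrA subrK.
  have rm0 : 0 <= r x / m x by rewrite divr_ge0 // ltW.
  have rm1 : r x / m x <= eta^-1.
    rewrite ler_pdivrMr // mulrC -ler_pdivrMr ?invr_gt0 // invrK.
    have [j hj] := Ax; apply: le_trans (fbm j x); rewrite fbA // fE normrM.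
    by rewrite (ger0_norm (r0 x)) ler_wpM2l.
  apply: le_trans (_ : r x / m x * p i x <= _).
    by apply: ler_wpM2l => //; have := p0 k x; lra.
  apply: ler_wpM2r => //; apply: le_trans rm1 _.
  by rewrite ler_peMl ?invr_ge0 ?ler1n // ltW.
(* Far out [w] has l1 norm 1, so some [|w j x|] is at least [1 / (n + 1)]. A positive such
   coordinate is large in [q]; a negative one lowers the minimum, and the last coordinate of [q] is
   large. *)
- exists (n.+1%:R^-1); first by rewrite invr_gt0 ltr0n.
  near=> x; have N1 : 1 <= l1norm (fb x) by near: x; exact: fbinf.
  have mE : m x = l1norm (fb x) by apply/max_idPr.
  have w_sum : \sum_j `|w j x| = 1.
    under eq_bigr do rewrite /w normrM normfV (gtr0_norm (m0 x)).
    by rewrite -mulr_suml -/(l1norm _) -mE mulfV // gt_eqF.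
  have [j hj] : exists j, n.+1%:R^-1 <= `|w j x|.
    by apply: exists_ge_mean; rewrite w_sum mulfV ?pnatr_eq0.
  have mn0 : mn x <= 0 by rewrite -(wt_max x).
  have mnj : mn x <= w j x by rewrite -wtj.
  have [wj|wj] := leP 0 (w j x).
    by exists (lift ord_max j); rewrite wtj; apply: le_trans hj _; rewrite ger0_norm //; lra.
  by exists ord_max; rewrite wt_max; apply: le_trans hj _; rewrite ltr0_norm //; lra.
Unshelve. all: by end_near. Qed.

(** The shrinking is given by [q i > 0]: the bound by [C * p i] puts these sets in [U i], the lower
    bound [c] makes them cover, and the zero among the [q i x] at each [x] empties their
    intersection. *)
Lemma dimc_covdim n : dimc_le d n -> covdim_le (higson_corona d) n.
Proof.
move=> dn; apply: covdim_le_shrink => U oU cU.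
have [p [p0 pU pc]] := corona_partition hd hp x0 oU cU.
have hs : higson d (fun x => \sum_i sval (p i) x).
  by apply: (higson_sum hd hp x0) => i; exact: (proj2_sig (p i)).
have w0 i w : higson_corona d w -> 0 <= w (p i).
  by move=> cw; apply: (corona_lb (x0 := x0) hd hp cw); exact: filterE.
have [|e e0 he] := @corona_gt0_far _ _ _ hd hp x0 (exist _ _ hs).
  move=> w cw; rewrite (corona_sum (s := index_enum _) (P := xpredT) (f := p) hp x0 cw) //.
  have [i wi] := pc w cw; rewrite (bigD1 i) //= ltr_pwDl //.
  by apply: sumr_ge0 => j _; exact: w0.
have [|q [hq q0 [C C0 qC] [c c0 qc]]] := dimc_shrink dn _ p0 e0 he.
  by move=> i; exact: (proj2_sig (p i)).
pose Q i : higson_fun d := exist _ _ (hq i).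
exists (fun i => [set v : {ptws higson_fun d -> (R : topologicalType)} | 0 < v (Q i)]).
split.
- by move=> i; exact: open_eval_gt0.
- move=> w cw; have [G [PG farG Gw]] := corona_escapes_to hp x0 cw.
  apply: contrapT => nw.
  have qw i : w (Q i) <= 0.
    by rewrite leNgt; apply/negP => h; apply: nw; exists i.
  have : \forall x \near G, forall i, q i x < c.
    apply: filter_forall => i; have /cvgr_lt := Gw (Q i).
    by apply; exact: le_lt_trans (qw i) c0.
  move=> /(filterI (farG _ qc))/filter_ex[x [[i hi] h]].
  by have := h i; rewrite ltNge hi.
- move=> i w [/= wq cw]; apply: pU => //; rewrite lt_neqAle w0 // andbT eq_sym.
  apply/eqP => wp; move: wq; apply/negP; rewrite -leNgt.
  have hCp : higson d (fun x => C * sval (p i) x).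
    by apply: (higsonZ hd hp x0); exact: (proj2_sig (p i)).
  have -> : 0 = w (exist _ _ hCp).
    rewrite (corona_mul (f := exist _ _ (higson_cst hd hp x0 C)) (g := p i) hp x0 cw) //.
    by rewrite wp mulr0.
  by apply: (corona_le (x0 := x0) hp cw); apply: filterS qC => x; exact.
- move=> w cw h; have [G [PG farG Gw]] := corona_escapes_to hp x0 cw.
  have : \forall x \near G, forall i, 0 < q i x.
    by apply: filter_forall => i; have /cvgr_gt := Gw (Q i); apply; exact: h.
  by move=> /filter_ex[x hx]; have [i qi] := q0 x; have := hx i; rewrite qi ltxx.
Qed.

End Shrinking.

(** * From covers of the corona to the extension property *)

Lemma mean_norm_attained (R : realFieldType) n (a : 'I_n.+1 -> R) :
  exists i, (\sum_j `|a j|) / n.+1%:R <= `|a i|.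
Proof.
by apply: exists_ge_mean; rewrite mulrC divfK // pnatr_eq0.
Qed.

(** In the Euclidean norm adding [b] does not shorten [a]; the factor [n + 1] pays for passing to
    the l1 norm. *)
Lemma l1_le_of_inner_ge0 (R : realFieldType) n (a b : 'I_n.+1 -> R) :
  0 <= \sum_i a i * b i -> \sum_i `|a i| <= n.+1%:R * \sum_i `|a i + b i|.
Proof.
move=> ab; have [i hi] := mean_norm_attained a.
rewrite mulrC -ler_pdivrMr ?ltr0n //; apply: le_trans hi _.
rewrite -[leRHS]ger0_norm ?sumr_ge0 // -ler_sqr ?nnegrE // !real_normK ?num_real //.
apply: le_trans (_ : \sum_j a j ^+ 2 <= _).
  by rewrite (bigD1 i) //= lerDl sumr_ge0 // => j _; exact: sqr_ge0.
apply: le_trans (_ : \sum_j (a j + b j) ^+ 2 <= _).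
  have -> : \sum_j (a j + b j) ^+ 2 =
      \sum_j a j ^+ 2 + (\sum_j b j ^+ 2 + 2 * \sum_j a j * b j).
    by rewrite mulr_sumr -!big_split; apply: eq_bigr => j _ /=; ring.
  rewrite lerDl addr_ge0 //; first by apply: sumr_ge0 => j _; exact: sqr_ge0.
  by rewrite mulr_ge0.
rewrite [leRHS]expr2 mulr_suml; apply: ler_sum => j _.
rewrite -real_normK ?num_real // expr2; apply: ler_wpM2l => //.
by rewrite (bigD1 j) //= lerDl sumr_ge0.
Qed.

Section Extending.
Variables (R : realType) (X : Type) (d : X -> X -> R).
Hypothesis hd : is_metric d.
Hypothesis hp : proper_metric d.
Variable x0 : X.
Local Notation far := (far d x0).
Local Notation T := {ptws higson_fun d -> (R : topologicalType)}.

Lemma corona_eval (w : T) (h : higson_fun d) (l : R) : higson_corona d w ->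
  (forall G, escapes_to x0 G w -> sval h @ G --> l) -> w h = l.
Proof.
move=> /(corona_escapes_to hp x0)[G eG] /(_ _ eG) hl; have [PG _ Gw] := eG.
exact: cvg_unique (Gw h) hl.
Qed.

(** Only the positive coefficients contribute, and the points that carry them are few enough to be
    linearly independent. *)
Lemma order_support m n (y : 'I_m -> R) (c : 'I_m -> 'rV[R]_n.+1) :
  (forall i, 0 <= y i) -> (exists i, 0 < y i) ->
  (#|[set i | (0 < y i)%R]%SET| <= n.+1)%N ->
  (forall (J : {set 'I_m}) (w : 'I_m -> R), (#|J| <= n.+1)%N ->
    \sum_(i in J) w i *: c i = 0 -> forall i, i \in J -> w i = 0) ->
  0 < \sum_l `|\sum_i y i * c i ord0 l|.
Proof.
move=> y0 [i yi] Jn cfree; rewrite lt_neqAle eq_sym sumr_ge0 // andbT.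
apply/negP; rewrite psumr_eq0 // => /allP h.
have := cfree _ y Jn _ i; rewrite inE => /(_ _ yi) yi0.
move: yi; rewrite yi0 ?ltxx //; apply/rowP => l.
rewrite summxE mxE; have := h l (mem_index_enum l); rewrite normr_eq0 => /eqP hl.
apply: etrans hl; rewrite [LHS]big_mkcond; apply: eq_bigr => j _; rewrite inE mxE.
by case: ltP => // yj; rewrite (le_anti (introT andP (conj yj (y0 j)))) mul0r.
Qed.

(* On the corona [phi] is a convex combination, up to a positive factor, of
   points close to the values of [u] in general position, so that it vanishes
   nowhere. *)
Lemma covdim_inessential n (u : 'I_n.+1 -> X -> R) :
  covdim_le (higson_corona d) n -> (forall l, higson d (u l)) ->
  (forall x, \sum_l `|u l x| <= 1) ->
  exists phi : 'I_n.+1 -> X -> R,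
    [/\ forall l, higson d (phi l),
        exists2 c, 0 < c & \forall x \near far, c <= \sum_l `|phi l x| &
        \forall x \near far, \sum_l `|u l x| = 1 -> 0 < \sum_l phi l x * u l x].
Proof.
move=> cn hu u1; pose U l : higson_fun d := exist _ _ (hu l).
(* [4 * del = 1 / (n + 1) ^ 2] bounds below the sum of squares of a vector of l1 norm 1. The error
   to absorb is [2 * del]: one [del] from the cover, one from moving to general position. *)
pose del : R := (4 * n.+1%:R ^+ 2)^-1.
have n0 : 0 < n.+1%:R :> R by rewrite ltr0n.
have del0 : 0 < del by rewrite invr_gt0 mulr_gt0 // exprn_gt0.
pose D (w : T) := [set v : T | forall l, `|w (U l) - v (U l)| < del].
have oD w : open (D w).
  rewrite openE => v Dv.
  suff : \forall z \near v, forall l, `|w (U l) - (z : T) (U l)| < del by [].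
  apply: (@filter_forall T _ (fun l z => `|w (U l) - z (U l)| < del) (nbhs v)) => l.
  have : (fun z : T => `|w (U l) - z (U l)|) @ nbhs v --> `|w (U l) - v (U l)|.
    by apply: cvg_norm; apply: cvgB; [exact: cvg_cst|exact: eval_cvg].
  by move=> /cvgr_lt; apply; exact: Dv.
have [||k [g [_ gcov]]] := @compact_finite_subcover _ _ _ (higson_corona d) D
    (corona_compact hd hp x0).
- by [].
- by move=> w cw; exists w => // l; rewrite subrr normr0.
have [m [V [oV cV VD Vord]]] := cn k (fun j => D (g j)) (fun j => oD (g j)) gcov.
have [p [p0 pV pc]] := corona_partition hd hp x0 oV cV.
have [j VDj] := choice VD.
pose a i : 'rV[R]_n.+1 := \row_l g (j i) (U l).
have [c [ca cfree]] := general_position a del0.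
pose phi l x := \sum_i sval (p i) x * c i ord0 l.
have hphi l : higson d (phi l).
  apply: (higson_sum hd hp x0) => i; apply: (higsonM hd hp x0).
    exact: (proj2_sig (p i)).
  exact: (higson_cst hd hp x0).
pose Phi l (w : T) := \sum_i w (p i) * c i ord0 l.
have phiG G w l : escapes_to x0 G w -> phi l @ G --> Phi l w.
  move=> [PG _ Gw]; apply: filter_cvg_sum => i; apply: cvgM; last exact: cvg_cst.
  exact: Gw.
have y0 i w : higson_corona d w -> 0 <= w (p i).
  by move=> cw; apply: (corona_lb (x0 := x0) hd hp cw); exact: filterE.
have hpsi1 : higson d (fun x => \sum_l `|phi l x|).
  by apply: (higson_sum hd hp x0) => l; exact: (higson_norm hd hp x0).
have hin : higson d (fun x => \sum_l phi l x * u l x).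
  by apply: (higson_sum hd hp x0) => l; exact: (higsonM hd hp x0).
have hdef : higson d (fun x => 1 - \sum_l `|u l x|).
  apply: (higsonB hd hp x0); first exact: (higson_cst hd hp x0).
  by apply: (higson_sum hd hp x0) => l; exact: (higson_norm hd hp x0).
have hpsi2 := higson_max hd hp x0 hin hdef.
exists phi; split => //.
  apply: (corona_gt0_far (f := exist _ _ hpsi1) hd hp x0) => w cw.
  rewrite (@corona_eval w _ (\sum_l `|Phi l w|) cw); last first.
    move=> G eG; have [PG _ _] := eG; apply: filter_cvg_sum => l; apply: cvg_norm.
    exact: phiG.
  apply: order_support => //; [by move=> i; exact: y0|exact: pc|].
  by apply: (Vord w cw) => i; rewrite inE => /pV; exact.
(* The conditional statement becomes positivity of one Higson function: where the l1 norm of [u] is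
   1 the second argument vanishes, and the maximum is positive only through the first. *)
suff [e e0 he] : exists2 e, 0 < e & \forall x \near far,
    e <= Num.max (\sum_l phi l x * u l x) (1 - \sum_l `|u l x|).
  apply: filterS he => x he ux; move: he; rewrite ux subrr le_max => /orP[|]; lra.
apply: (corona_gt0_far (f := exist _ _ hpsi2) hd hp x0) => w cw.
pose y i := w (p i); pose z l := w (U l).
have inE_ : w (exist _ _ hin) = \sum_l Phi l w * z l.
  apply: corona_eval cw _ => G eG; have [PG _ Gw] := eG.
  apply: filter_cvg_sum => l; apply: cvgM; first exact: phiG.
  exact: (Gw (U l)).
have defE : w (exist _ _ hdef) = 1 - \sum_l `|z l|.
  apply: corona_eval cw _ => G eG; have [PG _ Gw] := eG.
  apply: cvgB; first exact: cvg_cst.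
  apply: filter_cvg_sum => l; apply: cvg_norm; exact: (Gw (U l)).
have le1 : w (exist _ _ hin) <= w (exist _ _ hpsi2).
  by apply: (corona_le (x0 := x0) hp cw); apply: filterE => x /=; rewrite le_max lexx.
have le2 : w (exist _ _ hdef) <= w (exist _ _ hpsi2).
  by apply: (corona_le (x0 := x0) hp cw); apply: filterE => x /=; rewrite le_max lexx orbT.
have def0 : 0 <= w (exist _ _ hdef).
  by apply: (corona_lb (x0 := x0) hd hp cw); apply: filterE => x /=; rewrite subr_ge0.
move: def0; rewrite le_eqVlt => /orP[/eqP def0|def0]; last exact: lt_le_trans le2.
apply: lt_le_trans le1; rewrite inE_.
have z1 : \sum_l `|z l| = 1 by move: def0; rewrite defE; lra.
pose s := \sum_i y i.
have s0 : 0 < s.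
  have [i yi] := pc w cw; rewrite /s (bigD1 i) //= ltr_pwDl //.
  by apply: sumr_ge0 => i' _; exact: y0.
have close l : `|Phi l w - s * z l| <= s * (2 * del).
  rewrite /Phi /s mulr_suml -sumrB; apply: le_trans (ler_norm_sum _ _ _) _.
  rewrite mulr_suml; apply: ler_sum => i _; rewrite -mulrBr normrM ger0_norm ?y0 //.
  have := y0 i w cw; rewrite le_eqVlt => /orP[/eqP yi|yi].
    by rewrite /y -yi !mul0r.
  apply: ler_wpM2l; first exact: ltW.
  have [Dw _] : D (g (j i)) w /\ higson_corona d w by apply: VDj; split => //; exact: pV.
  have := Dw l; have := ca i l; rewrite /z mxE.
  by rewrite !ler_norml !ltr_norml; lra.
have [l0 hl0] := mean_norm_attained z; rewrite z1 in hl0.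
have zz : 4 * del <= \sum_l z l ^+ 2.
  rewrite (bigD1 l0) //=; apply: ler_wpDr.
    by apply: sumr_ge0 => l _; exact: sqr_ge0.
  rewrite -real_normK ?num_real //; apply: le_trans (_ : (1 / n.+1%:R) ^+ 2 <= _).
    rewrite /del invfM mulrA mulfV ?mul1r ?exprVn //.
  by rewrite lerXn2r ?nnegrE // divr_ge0.
have : s * (\sum_l z l ^+ 2 - 2 * del) <= \sum_l Phi l w * z l.
  have -> : 2 * del = \sum_l 2 * del * `|z l| by rewrite -mulr_sumr z1 mulr1.
  rewrite -sumrB mulr_sumr.
  apply: ler_sum => l _.
  have := ler_wpM2r (normr_ge0 (z l)) (close l); rewrite -normrM.
  have := ler_norm (- ((Phi l w - s * z l) * z l)); rewrite normrN => h1 h2.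
  have : - ((Phi l w - s * z l) * z l) <= s * (2 * del) * `|z l| by exact: le_trans h1 h2.
  by rewrite expr2; lra.
apply: lt_le_trans; apply: mulr_gt0 => //; lra.
Qed.

Lemma covdim_dimc n : covdim_le (higson_corona d) n -> dimc_le d n.
Proof.
move=> cn A clA f fc fp fl.
have hF j : exists F : X -> R, calip d F /\ forall a, A a -> F a = f a ord0 j.
  have [||F [F1 F2 F3]] := asymp_lip_extension hd clA (f := fun x => f x ord0 j).
  - by move: j; apply/mcont_coordP.
  - by move: j; apply/asymp_lip_coordP.
  - by exists F.
have {hF}[F hF] := choice hF.
have Fc j : calip d (F j) by have [] := hF j.
have FA j a : A a -> F j a = f a ord0 j by have [_] := hF j; exact.
pose N x := \sum_j `|F j x|.
have Nc : calip d N by apply: calip_sum => // j; exact: calip_norm.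
have N0 x : 0 <= N x by exact: sumr_ge0.
have [|||h [h0 h1 hinf hA]] := @slow_radius _ _ _ hd x0
    (fun x t => A x -> 2 * t <= N x).
- by move=> x _; rewrite mulr0.
- by move=> x s t _ st hN /hN; lra.
- move=> t; apply: filterS (mproper_far hd x0 fp (2 * t)) => x ht Ax.
  by apply: le_trans (ht Ax) _; apply: ler_sum => j _; rewrite FA.
have hc : calip d h by exact: calip_lipschitz.
pose m x := Num.max 1 (N x).
have mc : calip d m by apply: calip_max => //; exact: calip_cst.
have m1 x : 1 <= m x by rewrite le_max lexx.
have Nm x : N x <= m x by rewrite le_max lexx orbT.
have Fm j x : `|F j x| <= m x.
  by apply: le_trans (Nm x); rewrite /N (bigD1 j) //= lerDl sumr_ge0.
(* Including [h] makes the denominator tend to infinity even where [F] stays bounded, as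
   [higson_quotient] requires. *)
pose mu x := Num.max (m x) (h x).
have muc : calip d mu by exact: calip_max.
have mmu x : m x <= mu x by rewrite le_max lexx.
have mu1 x : 1 <= mu x by exact: le_trans (m1 x) (mmu x).
have mu0 x : 0 < mu x by exact: lt_le_trans (mu1 x).
pose u j x := F j x / mu x.
have hu j : higson d (u j).
  have [? ?] := Fc j; have [? ?] := muc.
  apply: (higson_quotient hd hp (x0 := x0)) => //.
    by move=> x; exact: le_trans (Fm j x) (mmu x).
  by move=> M; apply: filterS (hinf M) => x hM; rewrite /mu le_max hM orbT.
have uE x : \sum_j `|u j x| = N x / mu x.
  rewrite /N mulr_suml; apply: eq_bigr => j _.
  by rewrite /u normrM normfV (gtr0_norm (mu0 x)).
have u1 x : \sum_j `|u j x| <= 1.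
  by rewrite uE ler_pdivrMr // mul1r; exact: le_trans (Nm x) (mmu x).
have [phi [hphi [c c0 phic] phiu]] := covdim_inessential cn hu u1.
have [r [r0 r1 rinf rphi]] := higson_slow_radius hd hp x0 hphi.
have rc : calip d r by exact: calip_lipschitz.
(* [rho] is [m] for [m >= 2 * h] and 0 for [m <= h], while [kap] vanishes for [m >= 2 * h]. Since
   [2 * h <= m] on [A], the map [fb] restricts to [F] there. *)
pose rho x := Num.min (m x) (2 * Num.max 0 (m x - h x)).
pose kap x := Num.min (r x) (Num.max 0 (2 * h x - m x)).
have rhoc : calip d rho.
  apply: calip_min => //; apply: calipZ => //; apply: calip_max => //.
    exact: calip_cst.
  exact: calipB.
have kapc : calip d kap.
  apply: calip_min => //; apply: calip_max => //; first exact: calip_cst.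
  by apply: calipB => //; exact: calipZ.
have rho_m x : 0 <= rho x <= m x.
  rewrite ge_min lexx /= andbT le_min (le_trans ler01 (m1 x)) /=.
  by rewrite mulr_ge0 ?le_max ?lexx.
have kap_r x : 0 <= kap x <= r x.
  by rewrite ge_min lexx /= andbT le_min r0 le_max lexx.
pose fb x : 'rV[R]_n.+1 := \row_j (rho x / m x * F j x + kap x * phi j x).
have fbE x j : fb x ord0 j = rho x / m x * F j x + kap x * phi j x by rewrite mxE.
have fbc j : calip d (fun x => fb x ord0 j).
  under eq_fun do rewrite fbE; apply: calipD => //; first exact: calip_radial.
  by apply: (calip_mul_higson x0 (r := r)) => // x y; exact: rphi.
have fbcont : mcont_on d (@eucl R n.+1) setT fb.
  by apply/mcont_coordP => j; have [] := fbc j.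
exists fb; split => //.
- apply: (far_mproper hp (x0 := x0)) => //.
    by move=> x nx; exists 1.
  (* The factor [n + 1] compensates for the one lost in [l1_le_of_inner_ge0]. *)
  move=> M; pose K := `|M| * n.+1%:R.
  have K0 : 0 <= K by rewrite mulr_ge0.
  near=> x => _; apply: le_trans (ler_norm M) _.
  rewrite -(ler_pM2r (ltr0Sn R n)) -/K [leRHS]mulrC.
  have phicx : c <= \sum_l `|phi l x| by near: x.
  have hx1 : 1 < h x.
    by apply: lt_le_trans (_ : 2 <= _); [lra|near: x; exact: hinf].
  have hxK : K <= h x by near: x; exact: hinf.
  have hxKc : 2 * (K / c) <= h x by near: x; exact: hinf.
  have rxKc : K / c <= r x by near: x; exact: rinf.
  have m0 : 0 < m x by exact: lt_le_trans (m1 x).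
  have /andP[rho0 _] := rho_m x; have /andP[kap0 _] := kap_r x.
  (* The two summands of [fb] never cancel: for [m <= h] the first is 0, and for [m > h] the vector
     [u] has l1 norm 1, where its inner product with [phi] is positive. *)
  have inner : 0 <= \sum_j (rho x / m x * F j x) * (kap x * phi j x).
    have [mh|hm] := leP (m x) (h x).
      have -> : rho x = 0.
        rewrite /rho (_ : Num.max 0 _ = 0) ?mulr0; first by apply/min_idPr; exact: ltW.
        by apply/max_idPl; lra.
      by rewrite big1 // => j _; rewrite !mul0r.
    have NE : N x = m x.
      by have := hm; rewrite /m /Num.max; case: ifP => // _; lra.
    have muE : mu x = m x by apply/max_idPl; exact: ltW.
    have phiu0 : 0 < \sum_j phi j x * u j x.
      have : \sum_j `|u j x| = 1 by rewrite uE NE muE mulfV // gt_eqF.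
      by near: x.
    have -> : \sum_j (rho x / m x * F j x) * (kap x * phi j x) =
        rho x * kap x * \sum_j phi j x * u j x.
      rewrite mulr_sumr; apply: eq_bigr => j _; rewrite /u muE.
      by field; rewrite gt_eqF.
    by rewrite mulr_ge0 ?mulr_ge0 // ltW.
  have fbl : l1norm (fb x) = \sum_j `|rho x / m x * F j x + kap x * phi j x|.
    by apply: eq_bigr => j _; rewrite fbE.
  (* One summand is always large: from [m = 3 / 2 * h] on, [rho >= h]; below it, [kap] is at least
     the smaller of [r] and [h / 2]. *)
  have [m32|m32] := leP (3 * h x) (2 * m x).
    have NE : N x = m x.
      by have := m32; rewrite /m /Num.max; case: ifP => // _; lra.
    apply: le_trans (_ : rho x <= _).
      rewrite le_min (_ : Num.max 0 _ = m x - h x); last by apply/max_idPr; lra.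
      lra.
    rewrite fbl; apply: le_trans (l1_le_of_inner_ge0 inner).
    under eq_bigr do rewrite normrM ger0_norm ?divr_ge0 ?(ltW m0) //.
    by rewrite -mulr_sumr -/(N x) NE divfK // gt_eqF.
  have kapK : K <= kap x * c.
    rewrite -ler_pdivrMr // le_min rxKc /=.
    by rewrite (_ : Num.max 0 _ = 2 * h x - m x); [lra|apply/max_idPr; lra].
  apply: le_trans kapK _.
  have inner' : 0 <= \sum_j (kap x * phi j x) * (rho x / m x * F j x).
    by under eq_bigr do rewrite mulrC.
  rewrite fbl; under [X in _ <= _ * X]eq_bigr do rewrite addrC.
  apply: le_trans (l1_le_of_inner_ge0 inner').
  under eq_bigr do rewrite normrM ger0_norm //.
  by rewrite -mulr_sumr ler_wpM2l.
- by apply/asymp_lip_coordP => j; have [] := fbc j.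
- move=> a Aa; apply/rowP => j; rewrite fbE -FA //.
  have hN := hA a Aa; have Nma := Nm a; have h0a := h0 a.
  have -> : kap a = 0.
    rewrite /kap (_ : Num.max 0 _ = 0); first by apply/min_idPr.
    by apply/max_idPl; lra.
  have -> : rho a = m a.
    apply/min_idPl; rewrite (_ : Num.max 0 _ = m a - h a); first by lra.
    by apply/max_idPr; lra.
  by rewrite mul0r addr0 mulfV ?mul1r // gt_eqF // (lt_le_trans ltr01).
Unshelve. all: by end_near. Qed.

End Extending.

Theorem theorem7p6 (R : realType) (X : Type) (d : X -> X -> R)
  (hd : is_metric d) (hp : proper_metric d) (n : nat) :
  dimc_le d n <-> covdim_le (higson_corona d) n.
Proof.
have [[x0 _]|nX] := pselect (exists x : X, True).
  by split; [exact: (dimc_covdim hd hp x0)|exact: (covdim_dimc hd hp x0)].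
(* The empty space has no base point [x0]; its corona is empty and both sides hold. *)
have noX (x : X) : False by apply: nX; exists x.
split=> _.
- move=> k U _ _; have S0 w : ~ higson_corona d w.
    by move=> [clw _]; have [p [[x _ _] _]] := clw setT filterT; exact: noX x.
  exists 0%N, (fun=> set0); split.
  + by move=> i; exact: open0.
  + by move=> w /S0.
  + by move=> [].
  + by move=> w /S0.
- move=> A _ f _ _ _; exists (fun=> 0); split.
  + by move=> x; have := noX x.
  + move=> K _ I U _ _; have g (j : 'I_0) : I by case: j.
    by exists 0%N, g => x; have := noX x.
  + by exists 0, 0; split => // x; have := noX x.
  + by move=> x; have := noX x.
Qed.
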